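(* Let $A$ be a $C^*$-algebra, $H$ a Hilbert $A$-module, and let $P,Q\in\mathcal{L}(H)$ be two harmonious projections. Let $H_i$ and $P_i$ $(1\le i\le 6)$ be the submodules and projections associated with $(P,Q)$ as defined in the context, and let $$T=\begin{pmatrix} P_5QP_5|_{H_5} & P_5QP_6|_{H_6} \\ (P_5QP_6|_{H_6})^* & P_6QP_6|_{H_6} \end{pmatrix}\in\mathcal{L}(H_5\oplus H_6).$$ Let $Q_0\in\mathcal{L}(H_5)$ be the restriction of $P_5QP_5$ to $H_5$. Then both $Q_0$ and $I_{H_5}-Q_0$ are positive, injective and contractive, and there exists a unitary operator $U_0\in\mathcal{L}(H_6,H_5)$ such that $$T=\begin{pmatrix} Q_0 & Q_0^{\frac12}(I_{H_5}-Q_0)^{\frac12}U_0 \\ {U_0^*}Q_0^{\frac12}(I_{H_5}-Q_0)^{\frac12} & U_0^*(I_{H_5}-Q_0)U_0 \end{pmatrix}.$$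
   Context: $\mathcal{L}(H,K)$ is the set of adjointable operators between Hilbert $A$-modules, $\mathcal{L}(H)=\mathcal{L}(H,H)$; a projection is $P\in\mathcal{L}(H)$ with $P=P^2=P^*$; $\mathcal{R}$ and $\mathcal{N}$ denote range and null space. A closed submodule $M\subseteq H$ is orthogonally complemented in $H$ if $H=M+M^\perp$, where $M^\perp=\{x\in H:\langle x,y\rangle=0\ \forall y\in M\}$; then $P_M$ denotes the projection in $\mathcal{L}(H)$ with range $M$. Two projections $P,Q\in\mathcal{L}(H)$ are harmonious if the four closed submodules $\overline{\mathcal{R}(P+Q)}$, $\overline{\mathcal{R}(P+I-Q)}$, $\overline{\mathcal{R}(I-P+Q)}$, $\overline{\mathcal{R}(I-P+I-Q)}$ are all orthogonally complemented in $H$. For harmonious $P,Q$ set $H_1=\mathcal{R}(P)\cap\mathcal{R}(Q)$, $H_2=\mathcal{R}(P)\cap\mathcal{N}(Q)$, $H_3=\mathcal{N}(P)\cap\mathcal{R}(Q)$, $H_4=\mathcal{N}(P)\cap\mathcal{N}(Q)$ (these are the orthogonal complements of the four closures above, hence orthogonally complemented in $H$), $P_i=P_{H_i}$ for $i=1,2,3,4$, and $P_5=P-P_1-P_2$, $H_5=\mathcal{R}(P_5)$, $P_6=(I-P)-P_3-P_4$, $H_6=\mathcal{R}(P_6)$. The $P_i$ $(1\le i\le 6)$ are mutually orthogonal projections with sum $I$, and the unitary $U_{P,Q}:H\to\bigoplus_{i=1}^6H_i$, $U_{P,Q}(x)=(P_1x,\dots,P_6x)^T$, satisfies $U_{P,Q}PU_{P,Q}^*=I_{H_1}\oplus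 I_{H_2}\oplus0\oplus0\oplus I_{H_5}\oplus0$ and $U_{P,Q}QU_{P,Q}^*=I_{H_1}\oplus0\oplus I_{H_3}\oplus0\oplus T$. In the entries of $T$, $P_iQP_j|_{H_j}$ is regarded as an operator from $H_j$ to $H_i$. *)

(* Defs.v *)
From HB Require Import structures.
From mathcomp Require Import all_boot all_order all_algebra complex.
From mathcomp Require Import boolp classical_sets functions reals topology.
From mathcomp Require Import normedtype.

Set Implicit Arguments.
Unset Strict Implicit.
Unset Printing Implicit Defensive.

Import Order.TTheory GRing.Theory Num.Theory.
Import numFieldNormedType.Exports.

Local Open Scope classical_set_scope.
Local Open Scope ring_scope.

(* A C*-algebra, not assumed to be unital, hence not a MathComp ring. Over
   R[i] norms take values in R[i], where 0 <= z forces z to be real. *)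
HB.mixin Record isCStarAlgebra (R : realType) A
    & CompleteNormedModule R[i] A := {
  cmul : A -> A -> A;
  cstar : A -> A;
  cmulA : forall a b c, cmul a (cmul b c) = cmul (cmul a b) c;
  cmulDl : forall a b c, cmul (a + b) c = cmul a c + cmul b c;
  cmulDr : forall a b c, cmul a (b + c) = cmul a b + cmul a c;
  cmulZl : forall (l : R[i]) a b, cmul (l *: a) b = l *: cmul a b;
  cmulZr : forall (l : R[i]) a b, cmul a (l *: b) = l *: cmul a b;
  cnormM : forall a b, `|cmul a b| <= `|a| * `|b|;
  cstarD : forall a b, cstar (a + b) = cstar a + cstar b;
  cstarZ : forall (l : R[i]) a, cstar (l *: a) = l^* *: cstar a;
  cstarM : forall a b, cstar (cmul a b) = cmul (cstar b) (cstar a);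
  cstarK : forall a, cstar (cstar a) = a;
  cnorm_star : forall a, `|cmul (cstar a) a| = `|a| ^+ 2
}.

#[short(type="cstarAlgType")]
HB.structure Definition CStarAlgebra (R : realType) :=
  {A of CompleteNormedModule R[i] A & isCStarAlgebra R A}.

(* Positive elements of a C*-algebra are the b^* b; likewise positive_op below
   for the C*-algebra L(H). *)
Definition cpos (R : realType) (A : cstarAlgType R) (a : A) : Prop :=
  exists b : A, a = cmul (cstar b) b.

(* A complex vector space with a right A-action and a nondegenerate hermitian
   A-valued form, conjugate-linear on the left and A-linear on the right.
   Positivity and completeness only come with Hilbert modules below;
   adjointability does not refer to them. *)
HB.mixin Record isInnerModule (R : realType) (A : cstarAlgType R) H
    & GRing.Lmodule R[i] H := {
  ract : H -> A -> H;
  inner : H -> H -> A;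
  ractDl : forall x y a, ract (x + y) a = ract x a + ract y a;
  ractDr : forall x a b, ract x (a + b) = ract x a + ract x b;
  ractM : forall x a b, ract x (cmul a b) = ract (ract x a) b;
  ractZl : forall (l : R[i]) x a, ract (l *: x) a = l *: ract x a;
  ractZr : forall (l : R[i]) x a, ract x (l *: a) = l *: ract x a;
  innerDr : forall x y z, inner x (y + z) = inner x y + inner x z;
  innerZr : forall (l : R[i]) x y, inner x (l *: y) = l *: inner x y;
  innerMr : forall x y a, inner x (ract y a) = cmul (inner x y) a;
  inner_star : forall x y, cstar (inner x y) = inner y x;
  inner_nondeg : forall x, (forall y, inner x y = 0) -> x = 0
}.

#[short(type="innerModType")]
HB.structure Definition InnerModule (R : realType) (A : cstarAlgType R) :=
  {H of GRing.Lmodule R[i] H & isInnerModule R A H}.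

HB.mixin Record isHilbertModule (R : realType) (A : cstarAlgType R) H
    & CompleteNormedModule R[i] H & InnerModule R A H := {
  inner_ge0 : forall x : H, cpos (inner x x : A);
  norm_inner : forall x : H, `|x| ^+ 2 = `|inner x x : A|
}.

#[short(type="hilbertModType")]
HB.structure Definition HilbertModule (R : realType) (A : cstarAlgType R) :=
  {H of CompleteNormedModule R[i] H & InnerModule R A H
      & isHilbertModule R A H}.

Arguments inner {R A s} x y.
Arguments ract {R A s} x a.

Section InnerTheory.
Variables (R : realType) (A : cstarAlgType R).
Implicit Types H : innerModType A.

Lemma cstar0 : cstar (0 : A) = 0.
Proof. by rewrite -(scale0r (0 : A)) cstarZ conjC0 !scale0r. Qed.

Lemma cstarN (a : A) : cstar (- a) = - cstar a.
Proof. by rewrite -scaleN1r cstarZ rmorphN1 scaleN1r. Qed.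

Lemma cstarB (a b : A) : cstar (a - b) = cstar a - cstar b.
Proof. by rewrite cstarD cstarN. Qed.

Lemma cstar_norm (a : A) : `|cstar a| = `|a|.
Proof.
have le_star (b : A) : `|b| <= `|cstar b|.
  have [->|b0] := eqVneq b 0; first by rewrite normr0.
  have nb : 0 < `|b| by rewrite normr_gt0.
  by rewrite -(ler_pM2r nb) -expr2 -cnorm_star cnormM.
by apply/le_anti; rewrite le_star -{2}[a]cstarK le_star.
Qed.

Lemma inner_inj H (x y : H) : (forall z, inner z x = inner z y) -> x = y.
Proof.
move=> xy; apply/eqP; rewrite -subr_eq0; apply/eqP/inner_nondeg => z.
rewrite -inner_star innerDr -scaleN1r innerZr scaleN1r.
by rewrite xy subrr cstar0.
Qed.

Lemma innerNr H (x y : H) : inner x (- y) = - inner x y.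
Proof. by rewrite -scaleN1r innerZr scaleN1r. Qed.

Lemma innerBr H (x y z : H) : inner x (y - z) = inner x y - inner x z.
Proof. by rewrite innerDr innerNr. Qed.

Lemma inner0r H (x : H) : inner x 0 = 0.
Proof. by rewrite -(scale0r 0) innerZr scale0r. Qed.

Lemma innerDl H (x y z : H) : inner (x + y) z = inner x z + inner y z.
Proof. by rewrite -inner_star innerDr cstarD !inner_star. Qed.

Lemma innerNl H (x y : H) : inner (- x) y = - inner x y.
Proof. by rewrite -inner_star innerNr cstarN inner_star. Qed.

Lemma innerBl H (x y z : H) : inner (x - y) z = inner x z - inner y z.
Proof. by rewrite innerDl innerNl. Qed.

Lemma inner0l H (x : H) : inner 0 x = 0.
Proof. by rewrite -inner_star inner0r cstar0. Qed.

Lemma innerZl H (l : R[i]) (x y : H) : inner (l *: x) y = l^* *: inner x y.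
Proof. by rewrite -inner_star innerZr cstarZ inner_star. Qed.

Definition perp H (M : set H) : set H :=
  [set x | forall y, M y -> inner x y = 0].

Definition complemented H (M : set H) : Prop :=
  forall x, exists y z, [/\ M y, perp M z & x = y + z].

End InnerTheory.

(* L(H, K), an operator being bundled with its (unique) adjoint; linearity,
   A-linearity and boundedness are automatic. *)
Record adjointable (R : realType) (A : cstarAlgType R)
    (H K : innerModType A) := Adjointable {
  aop :> H -> K;
  aop_star : K -> H;
  aopP : forall x y, inner (aop x) y = inner x (aop_star y) }.

Section Adjointable.
Variables (R : realType) (A : cstarAlgType R).
Implicit Types H K L : innerModType A.

Lemma adjointable_eq H K (S T : adjointable H K) : S =1 T -> S = T.
Proof.
case: S T => [S S' SP] [T T' TP] /= /funext ST; subst T.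
have ST' : S' = T'.
  by apply/funext => y; apply: inner_inj => x; rewrite -SP -TP.
by subst T'; congr Adjointable; exact: Prop_irrelevance.
Qed.

Lemma adj_subproof H K (T : adjointable H K) x y :
  inner (aop_star T x) y = inner x (T y).
Proof. by rewrite -inner_star -aopP inner_star. Qed.
Definition adj H K (T : adjointable H K) : adjointable K H :=
  Adjointable (adj_subproof T).

Lemma adjP H K (T : adjointable H K) x y :
  inner (T x) y = inner x (adj T y).
Proof. exact: aopP. Qed.

Lemma adjK H K (T : adjointable H K) : adj (adj T) = T.
Proof. exact: adjointable_eq. Qed.

Lemma aopD H K (T : adjointable H K) : {morph T : x y / x + y}.
Proof.
by move=> x y; apply: inner_inj => z; rewrite innerDr -!adj_subproof innerDr.
Qed.

Lemma aopZ H K (T : adjointable H K) (l : R[i]) : {morph T : x / l *: x}.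
Proof.
by move=> x; apply: inner_inj => z; rewrite innerZr -!adj_subproof innerZr.
Qed.

Lemma aopN H K (T : adjointable H K) : {morph T : x / - x}.
Proof. by move=> x; rewrite -scaleN1r aopZ scaleN1r. Qed.

Lemma aopB H K (T : adjointable H K) : {morph T : x y / x - y}.
Proof. by move=> x y; rewrite aopD aopN. Qed.

Lemma aop0 H K (T : adjointable H K) : T 0 = 0.
Proof. by rewrite -(scale0r 0) aopZ scale0r. Qed.

Lemma aopM H K (T : adjointable H K) (a : A) x : T (ract x a) = ract (T x) a.
Proof.
by apply: inner_inj => z; rewrite innerMr -!adj_subproof innerMr.
Qed.

HB.instance Definition _ H K := gen_eqMixin (adjointable H K).
HB.instance Definition _ H K := gen_choiceMixin (adjointable H K).

Lemma azero_subproof H K x y : inner (0 : K) y = inner (x : H) 0.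
Proof. by rewrite inner0l inner0r. Qed.
Definition azero H K : adjointable H K :=
  Adjointable (@azero_subproof H K).

Lemma aopp_subproof H K (T : adjointable H K) x y :
  inner (- T x) y = inner x (- adj T y).
Proof. by rewrite innerNl innerNr adjP. Qed.
Definition aopp H K (T : adjointable H K) : adjointable H K :=
  Adjointable (aopp_subproof T).

Lemma aadd_subproof H K (S T : adjointable H K) x y :
  inner (S x + T x) y = inner x (adj S y + adj T y).
Proof. by rewrite innerDl innerDr !adjP. Qed.
Definition aadd H K (S T : adjointable H K) : adjointable H K :=
  Adjointable (aadd_subproof S T).

Lemma aaddA H K : associative (@aadd H K).
Proof. by move=> S T U; apply: adjointable_eq => x /=; rewrite addrA. Qed.
Lemma aaddC H K : commutative (@aadd H K).
Proof. by move=> S T; apply: adjointable_eq => x /=; rewrite addrC. Qed.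
Lemma aadd0 H K : left_id (azero H K) (@aadd H K).
Proof. by move=> S; apply: adjointable_eq => x /=; rewrite add0r. Qed.
Lemma aaddN H K : left_inverse (azero H K) (@aopp H K) (@aadd H K).
Proof. by move=> S; apply: adjointable_eq => x /=; rewrite addNr. Qed.

HB.instance Definition _ H K := GRing.isZmodule.Build (adjointable H K)
  (@aaddA H K) (@aaddC H K) (@aadd0 H K) (@aaddN H K).

Lemma aid_subproof H (x y : H) : inner x y = inner x y.
Proof. by []. Qed.
Definition aid H : adjointable H H := Adjointable (@aid_subproof H).

Lemma acomp_subproof H K L (S : adjointable K L) (T : adjointable H K) x y :
  inner (S (T x)) y = inner x (adj T (adj S y)).
Proof. by rewrite !adjP. Qed.
Definition acomp H K L (S : adjointable K L) (T : adjointable H K) :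
  adjointable H L := Adjointable (acomp_subproof S T).

End Adjointable.

Arguments aid {R A} H.
Notation "S \oA T" := (acomp S T) (at level 40, left associativity) : ring_scope.

Section OperatorNotions.
Variables (R : realType) (A : cstarAlgType R).

Definition unitary_op (H K : innerModType A) (U : adjointable H K) : Prop :=
  adj U \oA U = aid H /\ U \oA adj U = aid K.

Definition positive_op (H : innerModType A) (T : adjointable H H) : Prop :=
  exists S : adjointable H H, T = adj S \oA S.

Definition contractive_op (H K : hilbertModType A) (T : adjointable H K) : Prop :=
  forall x, `|T x| <= `|x|.

(* The positive square root T^(1/2) of a positive T. It exists and is unique, so
   that the default value 0 is only taken when T is not positive. *)
Definition asqrt (H : hilbertModType A) (T : adjointable H H) :
  adjointable H H := xget 0 [set S | positive_op S /\ S \oA S = T].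

End OperatorNotions.

(* The direct sum of Hilbert modules, with the sum of the inner products. Only
   this inner product matters for L(H (+) K); the library's sup norm on pairs
   is not the Hilbert module norm and is not used. *)
Section DirectSum.
Variables (R : realType) (A : cstarAlgType R) (H K : innerModType A).
Implicit Types x y : (H * K)%type.

Definition dsum_ract x (a : A) : (H * K)%type := (ract x.1 a, ract x.2 a).
Definition dsum_inner x y : A := inner x.1 y.1 + inner x.2 y.2.

Lemma dsum_ractDl x y a : dsum_ract (x + y) a = dsum_ract x a + dsum_ract y a.
Proof. by rewrite /dsum_ract/= !ractDl. Qed.
Lemma dsum_ractDr x a b : dsum_ract x (a + b) = dsum_ract x a + dsum_ract x b.
Proof. by rewrite /dsum_ract/= !ractDr. Qed.
Lemma dsum_ractM x a b :
  dsum_ract x (cmul a b) = dsum_ract (dsum_ract x a) b.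
Proof. by rewrite /dsum_ract/= !ractM. Qed.
Lemma dsum_ractZl (l : R[i]) x a : dsum_ract (l *: x) a = l *: dsum_ract x a.
Proof. by rewrite /dsum_ract/= !ractZl. Qed.
Lemma dsum_ractZr (l : R[i]) x a : dsum_ract x (l *: a) = l *: dsum_ract x a.
Proof. by rewrite /dsum_ract/= !ractZr. Qed.
Lemma dsum_innerDr x y z :
  dsum_inner x (y + z) = dsum_inner x y + dsum_inner x z.
Proof. by rewrite /dsum_inner/= !innerDr addrACA. Qed.
Lemma dsum_innerZr (l : R[i]) x y :
  dsum_inner x (l *: y) = l *: dsum_inner x y.
Proof. by rewrite /dsum_inner/= !innerZr scalerDr. Qed.
Lemma dsum_innerMr x y a :
  dsum_inner x (dsum_ract y a) = cmul (dsum_inner x y) a.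
Proof. by rewrite /dsum_inner/= !innerMr cmulDl. Qed.
Lemma dsum_inner_star x y : cstar (dsum_inner x y) = dsum_inner y x.
Proof. by rewrite /dsum_inner/= cstarD !inner_star. Qed.
Lemma dsum_inner_nondeg x : (forall y, dsum_inner x y = 0) -> x = 0.
Proof.
case: x => x1 x2 x0; congr pair; apply: inner_nondeg => y.
  by rewrite -(x0 (y, 0)) /dsum_inner/= inner0r addr0.
by rewrite -(x0 (0, y)) /dsum_inner/= inner0r add0r.
Qed.

HB.instance Definition _ := isInnerModule.Build R A (H * K)%type
  dsum_ractDl dsum_ractDr dsum_ractM dsum_ractZl dsum_ractZr
  dsum_innerDr dsum_innerZr dsum_innerMr dsum_inner_star dsum_inner_nondeg.

End DirectSum.

Section BlockOperator.
Variables (R : realType) (A : cstarAlgType R) (H1 H2 K1 K2 : innerModType A).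
Variables (a : adjointable H1 K1) (b : adjointable H2 K1).
Variables (c : adjointable H1 K2) (d : adjointable H2 K2).

Lemma block_subproof (x : (H1 * H2)%type) (y : (K1 * K2)%type) :
  inner ((a x.1 + b x.2, c x.1 + d x.2) : (K1 * K2)%type) y =
  inner x ((adj a y.1 + adj c y.2, adj b y.1 + adj d y.2) : (H1 * H2)%type).
Proof.
rewrite /inner/= /dsum_inner/= !innerDl !innerDr !adjP.
by rewrite addrACA.
Qed.

(* The operator matrix (a b; c d), acting on column vectors. *)
Definition block_op : adjointable (H1 * H2)%type (K1 * K2)%type :=
  Adjointable block_subproof.

End BlockOperator.

Record projection (R : realType) (A : cstarAlgType R) (H : innerModType A) :=
  Projection {
    proj_op :> adjointable H H;
    proj_idem : proj_op \oA proj_op = proj_op;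
    proj_adj : adj proj_op = proj_op }.

Section Projections.
Variables (R : realType) (A : cstarAlgType R) (H : hilbertModType A).
Implicit Types P Q E F : projection H.

Lemma projK P x : P (P x) = P x.
Proof. by rewrite -[in RHS]proj_idem. Qed.

Lemma projP P x y : inner (P x) y = inner x (P y).
Proof. by rewrite adjP proj_adj. Qed.

Lemma range_projP P x : range P x <-> P x = x.
Proof. by split=> [[y _ <-]|<-]; [rewrite projK|exists x]. Qed.

(* A crude Cauchy-Schwarz inequality, obtained by polarization, which is enough
   for the continuity of the inner product. *)
Lemma inner_bound (x y : H) : `|inner x y : A| <= 4 * (`|x| * `|y|).
Proof.
have key (u v : H) : `|inner u v : A| <= (`|u| + `|v|) ^+ 2.
  have quad (l : R[i]) : `|l| = 1 ->
      `|inner (u + l *: v) (u + l *: v) : A| <= (`|u| + `|v|) ^+ 2.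
    move=> l1; rewrite -norm_inner lerXn2r ?nnegrE ?addr_ge0//.
    by rewrite (le_trans (ler_normD _ _))// normrZ l1 mul1r.
  have i1 : `|'i : R[i]| = 1 by exact: normCi.
  pose q (l : R[i]) : A := inner (u + l *: v) (u + l *: v)
                           - inner (u - l *: v) (u - l *: v).
  have zz (a p r d : A) : (a + r + (p + d)) - (a - r - (p - d)) = 2 *: (p + r).
    rewrite scaler_nat mulr2n !opprB [p - d + _]addrC addrACA [a + r]addrC.
    rewrite [r + a + _]addrACA subrr addr0 [p + d + _]addrACA subrr addr0.
    by rewrite addrACA [r + p]addrC.
  have qE l : q l = 2 *: (l^* *: inner v u + l *: inner u v).
    rewrite -(zz (inner u u) _ _ (l *: (l^* *: inner v v))) /q.
    rewrite innerBl !innerBr innerDl !innerDr !innerZl !innerZr.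
    by rewrite scalerA [l^* * l]mulrC -scalerA.
  have e : 4 *: inner u v = q 1 - 'i *: q 'i :> A.
    rewrite !qE conjC1 conjCi !scale1r scalerA mulrC -scalerA -scalerBr.
    rewrite ['i *: (_ + _)]scalerDr !scalerA mulrN -expr2 sqrCi opprK scale1r scaleN1r.
    rewrite opprB addrC addrA addrNK -[X in 2 *: (X + X)]scale1r -scalerDl scalerA.
    by congr (_ *: _); rewrite -(natrD _ 1 1) -natrM.
  rewrite -(ler_pM2l (_ : 0 < 4 :> R[i]))// -[4 in leLHS]ger0_norm//.
  rewrite -normrZ e (le_trans (ler_normB _ _))// normrZ i1 mul1r.
  have -> : 4 * (`|u| + `|v|) ^+ 2 = ((`|u| + `|v|) ^+ 2 + (`|u| + `|v|) ^+ 2)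
    + ((`|u| + `|v|) ^+ 2 + (`|u| + `|v|) ^+ 2).
    by rewrite -!mulr2n -mulrnA mulr_natl.
  have q_le l : `|l| = 1 -> `|q l| <= (`|u| + `|v|) ^+ 2 + (`|u| + `|v|) ^+ 2.
    move=> l1; rewrite (le_trans (ler_normB _ _))// -scaleNr lerD// quad//.
    by rewrite normrN.
  by rewrite lerD// q_le ?normr1.
have [->|x0] := eqVneq x 0; first by rewrite inner0l !normr0 mul0r mulr0.
have [->|y0] := eqVneq y 0; first by rewrite inner0r !normr0 !mulr0.
have xy0 : 0 < `|x| * `|y| by rewrite mulr_gt0 ?normr_gt0.
have := key (`|y| *: x) (`|x| *: y).
rewrite innerZl innerZr !normrZ norm_conjC !normr_id [`|y| * `|x|]mulrC.
rewrite mulrA [`|y| * `|x|]mulrC.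
have -> (t : R[i]) : (t + t) ^+ 2 = t * (4 * t).
  by rewrite -mulr2n exprMn_n expr2 mulr_natl -mulrnAr.
by rewrite ler_pM2l.
Qed.

Lemma proj_closed P (x : H) :
  (forall e : R[i], 0 < e -> exists2 y, range P y & `|x - y| < e) ->
  range P x.
Proof.
move=> xP; apply/range_projP/esym/eqP; rewrite -subr_eq0; apply/eqP.
apply: inner_nondeg => w; apply/normr0_eq0/eqP; rewrite eq_le normr_ge0 andbT.
apply/ler_addgt0Pr => e e0; rewrite add0r.
set v := w - P w.
have v0 : 0 < 4 * (`|v| + 1) by rewrite mulr_gt0 ?ltr_wpDl.
have [y /range_projP Py xy] := xP (e / (4 * (`|v| + 1))) (divr_gt0 e0 v0).
have -> : inner (x - P x) w = inner (x - y) v.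
  rewrite innerBl projP -innerBr -/v innerBl.
  suff -> : inner y v = 0 by rewrite subr0.
  by rewrite -Py projP /v aopB projK subrr inner0r.
rewrite (le_trans (inner_bound _ _))//.
have : `|x - y| * (4 * (`|v| + 1)) <= e by rewrite -ler_pdivlMr// ltW.
by apply: le_trans; rewrite mulrCA ler_wpM2l// ler_wpM2l// lerDl.
Qed.

End Projections.

(* R(P) as a Hilbert module, for a projection P. *)
Section Range.
Variables (R : realType) (A : cstarAlgType R) (H : hilbertModType A).
Variable P : projection H.

Definition in_rng : {pred H} := fun x => `[< range P x >].

Lemma in_rngP x : reflect (P x = x) (x \in in_rng).
Proof. by apply: (iffP (asboolP _)) => /range_projP. Qed.

Lemma in_rng_submod : submod_closed in_rng.
Proof.
split; first by apply/in_rngP; rewrite aop0.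
by move=> l x y /in_rngP Px /in_rngP Py; apply/in_rngP; rewrite aopD aopZ Px Py.
Qed.

HB.instance Definition _ :=
  GRing.isSubmodClosed.Build R[i] H in_rng in_rng_submod.

Record rng := Rng { rng_val : H; rng_valP : rng_val \in in_rng }.

HB.instance Definition _ := [isSub for rng_val].
HB.instance Definition _ := [Choice of rng by <:].
HB.instance Definition _ := [SubChoice_isSubLmodule of rng by <:].

Lemma rngP (x : rng) : P (val x) = val x.
Proof. exact/in_rngP/rng_valP. Qed.

Lemma to_rng_subproof x : P x \in in_rng.
Proof. by apply/in_rngP; rewrite projK. Qed.
Definition to_rng x : rng := Rng (to_rng_subproof x).

Lemma to_rngK (x : rng) : to_rng (val x) = x.
Proof. by apply: val_inj; rewrite /= rngP. Qed.

Definition rng_norm (x : rng) : R[i] := `|val x|.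

Lemma rng_normD x y : rng_norm (x + y) <= rng_norm x + rng_norm y.
Proof. exact: ler_normD. Qed.
Lemma rng_normZ (l : R[i]) x : rng_norm (l *: x) = `|l| * rng_norm x.
Proof. exact: normrZ. Qed.
Lemma rng_norm0 x : rng_norm x = 0 -> x = 0.
Proof. by move=> /normr0_eq0 x0; exact: val_inj. Qed.

HB.instance Definition _ :=
  Lmodule_isNormed.Build R[i] rng rng_normD rng_normZ rng_norm0.

Lemma rng_normE (x : rng) : `|x| = `|val x|.
Proof. by []. Qed.

Lemma rng_complete (F : set_system rng) : ProperFilter F -> cauchy F -> cvg F.
Proof.
move=> FF /cauchy_ballP Fc.
have : cauchy (val @ F).
  apply/cauchy_ballP => e e0; near_simpl.
  by apply: filterS (Fc e e0) => -[a b]; rewrite -!ball_normE.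
move=> /cauchy_cvg /cvg_ex[l Fl].
have Fle (e : R[i]) : 0 < e -> \forall x \near F, `|l - val x| < e.
  by move=> e0; move/cvgrPdist_lt : Fl => /(_ e e0).
have rl : l \in in_rng.
  apply/asboolP/proj_closed => e e0; have [x xe] := filter_ex (Fle e e0).
  by exists (val x) => //; apply/range_projP; exact: rngP.
apply/cvg_ex; exists (Rng rl); apply/cvgrPdist_lt => e e0.
by apply: filterS (Fle e e0).
Qed.

HB.instance Definition _ := Uniform_isComplete.Build rng rng_complete.

Lemma rng_ract_subproof (x : rng) (a : A) : ract (val x) a \in in_rng.
Proof. by apply/in_rngP; rewrite aopM rngP. Qed.

Definition rng_ract (x : rng) (a : A) : rng := Rng (rng_ract_subproof x a).
Definition rng_inner (x y : rng) : A := inner (val x) (val y).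

Lemma rng_ractDl x y a : rng_ract (x + y) a = rng_ract x a + rng_ract y a.
Proof. by apply: val_inj; exact: ractDl. Qed.
Lemma rng_ractDr x a b : rng_ract x (a + b) = rng_ract x a + rng_ract x b.
Proof. by apply: val_inj; exact: ractDr. Qed.
Lemma rng_ractM x a b : rng_ract x (cmul a b) = rng_ract (rng_ract x a) b.
Proof. by apply: val_inj; exact: ractM. Qed.
Lemma rng_ractZl (l : R[i]) x a : rng_ract (l *: x) a = l *: rng_ract x a.
Proof. by apply: val_inj; exact: ractZl. Qed.
Lemma rng_ractZr (l : R[i]) x a : rng_ract x (l *: a) = l *: rng_ract x a.
Proof. by apply: val_inj; exact: ractZr. Qed.
Lemma rng_innerDr x y z : rng_inner x (y + z) = rng_inner x y + rng_inner x z.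
Proof. exact: innerDr. Qed.
Lemma rng_innerZr (l : R[i]) x y : rng_inner x (l *: y) = l *: rng_inner x y.
Proof. exact: innerZr. Qed.
Lemma rng_innerMr x y a : rng_inner x (rng_ract y a) = cmul (rng_inner x y) a.
Proof. exact: innerMr. Qed.
Lemma rng_inner_star x y : cstar (rng_inner x y) = rng_inner y x.
Proof. exact: inner_star. Qed.
Lemma rng_inner_nondeg x : (forall y, rng_inner x y = 0) -> x = 0.
Proof.
move=> x0; apply: val_inj; apply: inner_nondeg => y.
by rewrite -rngP projP; exact: (x0 (to_rng y)).
Qed.

HB.instance Definition _ := isInnerModule.Build R A rng
  rng_ractDl rng_ractDr rng_ractM rng_ractZl rng_ractZr
  rng_innerDr rng_innerZr rng_innerMr rng_inner_star rng_inner_nondeg.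

Lemma rng_inner_ge0 (x : rng) : cpos (inner x x : A).
Proof. exact: inner_ge0. Qed.
Lemma rng_norm_inner (x : rng) : `|x| ^+ 2 = `|inner x x : A|.
Proof. exact: norm_inner. Qed.

HB.instance Definition _ :=
  isHilbertModule.Build R A rng rng_inner_ge0 rng_norm_inner.

End Range.

Section Harmonious.
Variables (R : realType) (A : cstarAlgType R) (H : hilbertModType A).
Implicit Types P Q E F : projection H.

Definition kernel (T : adjointable H H) : set H := [set x | T x = 0].

Definition op_range (T : adjointable H H) : set H := range T.

Definition harmonious P Q : Prop :=
  let p := proj_op P in let q := proj_op Q in
  [/\ complemented (closure (op_range (p + q))),
      complemented (closure (op_range (p + (aid H - q)))),
      complemented (closure (op_range ((aid H - p) + q))) &
      complemented (closure (op_range ((aid H - p) + (aid H - q))))].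

Definition H1 P Q : set H := range P `&` range Q.
Definition H2 P Q : set H := range P `&` kernel Q.
Definition H3 P Q : set H := kernel P `&` range Q.
Definition H4 P Q : set H := kernel P `&` kernel Q.

Lemma projC_idem P : (aid H - proj_op P) \oA (aid H - proj_op P) = aid H - proj_op P.
Proof. by apply: adjointable_eq => x /=; rewrite aopB projK subrr subr0. Qed.
Lemma projC_adj P : adj (aid H - proj_op P) = aid H - proj_op P.
Proof. by apply: adjointable_eq => x /=; rewrite -[in RHS]proj_adj. Qed.
Definition projC P : projection H := Projection (projC_idem P) (projC_adj P).

Lemma range_projC P : range (projC P) = kernel P.
Proof.
apply/seteqP; split=> [x /(range_projP (projC P) x) <-|x Px].
  by rewrite /kernel/= aopB projK subrr.
by apply/range_projP; rewrite /= Px subr0.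
Qed.

Lemma kernel_projC P : kernel (projC P) = range P.
Proof.
apply/seteqP; split=> [x /= /eqP|x /range_projP Px].
  by rewrite subr_eq0 => /eqP xP; apply/range_projP; rewrite -xP.
by rewrite /kernel/= Px subrr.
Qed.

Lemma perp_closure_range E F :
  perp (closure (op_range (proj_op E + proj_op F))) = kernel E `&` kernel F.
Proof.
apply/seteqP; split=> [x xM|x [/= Ex Fx]].
  have EF : E x = - F x.
    apply/eqP; rewrite -subr_eq0 opprK; apply/eqP/inner_nondeg => y.
    rewrite innerDl !projP -innerDr xM//; apply: subset_closure.
    by exists y.
  have nE : inner (E x) (E x) = - inner (E x) (E x) :> A.
    have sq G : inner (proj_op G x) (G x) = inner (G x) x :> A.
      by rewrite -projP projK.
    rewrite [LHS]sq {1}EF innerNl -sq; congr (- _).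
    by rewrite EF innerNl innerNr opprK.
  have Ex : E x = 0.
    apply/normr0_eq0/eqP; rewrite -sqrf_eq0 norm_inner normr_eq0.
    move/eqP: nE; rewrite -subr_eq0 opprK -mulr2n -scaler_nat scaler_eq0.
    by rewrite pnatr_eq0.
  by split; rewrite /kernel//= -[F x]opprK -EF Ex oppr0.
move=> y /= yM; apply/normr0_eq0/eqP; rewrite eq_le normr_ge0 andbT.
apply/ler_addgt0Pr => e e0; rewrite add0r.
have x0 : 0 < 4 * (`|x| + 1) by rewrite mulr_gt0 ?ltr_wpDl.
have [_ [[z _ <-] /= zy]] := yM _ (nbhsx_ballx y _ (divr_gt0 e0 x0)).
have -> : inner x y = inner x (y - (E z + F z)).
  by rewrite innerBr innerDr -!projP Ex Fx !inner0l addr0 subr0.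
rewrite (le_trans (inner_bound _ _))//.
move: zy; rewrite -ball_normE /= ltr_pdivlMr// => /ltW; apply: le_trans.
by rewrite mulrA mulrC ler_wpM2l// ler_wpM2l// lerDl.
Qed.

Lemma ex_proj_perp (M : set H) :
  complemented M -> exists G : projection H, range G = perp M.
Proof.
move=> Mc; pose N := perp M.
have NB x y : N x -> N y -> N (x - y).
  by move=> Nx Ny z Mz; rewrite innerBl Nx// Ny// subrr.
have dec x : exists z, N z /\ M (x - z).
  by have [y [z [My Nz ->]]] := Mc x; exists z; rewrite addrK.
have uniq x z z' : N z -> M (x - z) -> N z' -> M (x - z') -> z = z'.
  move=> Nz Mz Nz' Mz'; apply/eqP; rewrite -subr_eq0.
  have : inner (z - z') (z - z') = 0 :> A.
    have -> : inner (z - z') (z - z')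
        = inner (z - z') (x - z') - inner (z - z') (x - z) :> A.
      by rewrite -innerBr; congr inner; rewrite opprB [RHS]addrC addrA addrNK.
    by rewrite !(NB _ _ Nz Nz')// subrr.
  move=> zz; rewrite -normr_eq0 -sqrf_eq0 norm_inner zz normr0//.
pose g x := projT1 (cid (dec x)).
have gN x : N (g x) by rewrite /g; case: cid => z [].
have gM x : M (x - g x) by rewrite /g; case: cid => z [].
have gP x y : inner (g x) y = inner x (g y) :> A.
  rewrite -[in LHS](addrNK (g y) y) -[in RHS](addrNK (g x) x).
  rewrite innerDr innerDl (gN x _ (gM y)) -[inner (x - _) _]inner_star.
  by rewrite (gN y _ (gM x)) cstar0.
pose T := Adjointable gP.
have gid x : N x -> g x = x.
  have M0 : M 0.
    have [y [z [My Nz]]] := Mc 0.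
    move/esym/eqP; rewrite addr_eq0 => /eqP yz.
    suff -> : (0 : H) = y by [].
    apply/eqP; rewrite eq_sym -normr_eq0 -sqrf_eq0 norm_inner {1}yz innerNl.
    by rewrite Nz// oppr0 normr0.
  by move=> Nx; apply: (uniq x) => //; rewrite subrr.
have TT : T \oA T = T by apply: adjointable_eq => x /=; rewrite gid.
have Ta : adj T = T by exact: adjointable_eq.
exists (Projection TT Ta); apply/seteqP; split=> [_ [x _ <-]|x Nx] /=.
  exact: gN.
by exists x => //=; rewrite gid.
Qed.

Lemma ex_proj_H1 P Q :
  harmonious P Q -> exists G : projection H, range G = H1 P Q.
Proof.
case=> _ _ _ /ex_proj_perp[G GE]; exists G; rewrite GE.
by rewrite (perp_closure_range (projC P) (projC Q)) !kernel_projC.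
Qed.

Lemma ex_proj_H2 P Q :
  harmonious P Q -> exists G : projection H, range G = H2 P Q.
Proof.
case=> _ _ /ex_proj_perp[G GE] _; exists G; rewrite GE.
by rewrite (perp_closure_range (projC P) Q) kernel_projC.
Qed.

Lemma ex_proj_H3 P Q :
  harmonious P Q -> exists G : projection H, range G = H3 P Q.
Proof.
case=> _ /ex_proj_perp[G GE] _ _; exists G; rewrite GE.
by rewrite (perp_closure_range P (projC Q)) kernel_projC.
Qed.

Lemma ex_proj_H4 P Q :
  harmonious P Q -> exists G : projection H, range G = H4 P Q.
Proof.
case=> /ex_proj_perp[G GE] _ _ _; exists G; rewrite GE.
exact: (perp_closure_range P Q).
Qed.

Lemma proj_leC E P : range E `<=` range P -> E \oA P = E.
Proof.
move=> EP; apply: adjointable_eq => x /=; apply: inner_inj => y.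
rewrite -[LHS]projP -[LHS]projP -[RHS]projP; congr inner.
by apply/range_projP/EP; exists y.
Qed.

Lemma projB_idem E P : range E `<=` range P ->
  (proj_op P - proj_op E) \oA (proj_op P - proj_op E) = proj_op P - proj_op E.
Proof.
move=> EP; apply: adjointable_eq => x /=.
have /EP/range_projP PE : range E (E x) by exists x.
have EPx : E (P x) = E x by rewrite -[in RHS](proj_leC EP).
by rewrite !aopB !projK PE EPx subrr subr0.
Qed.
Lemma projB_adj E P : adj (proj_op P - proj_op E) = proj_op P - proj_op E.
Proof.
by apply: adjointable_eq => x /=; rewrite -[in RHS](proj_adj P)
  -[in RHS](proj_adj E).
Qed.
Definition projB E P (EP : range E `<=` range P) : projection H :=
  Projection (projB_idem EP) (projB_adj E P).

Section Pieces.
Variables (P Q : projection H) (h : harmonious P Q).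

Definition P1 : projection H := projT1 (cid (ex_proj_H1 h)).
Definition P2 : projection H := projT1 (cid (ex_proj_H2 h)).
Definition P3 : projection H := projT1 (cid (ex_proj_H3 h)).
Definition P4 : projection H := projT1 (cid (ex_proj_H4 h)).

Lemma range_P1 : range P1 = H1 P Q.
Proof. exact: (projT2 (cid (ex_proj_H1 h))). Qed.
Lemma range_P2 : range P2 = H2 P Q.
Proof. exact: (projT2 (cid (ex_proj_H2 h))). Qed.
Lemma range_P3 : range P3 = H3 P Q.
Proof. exact: (projT2 (cid (ex_proj_H3 h))). Qed.
Lemma range_P4 : range P4 = H4 P Q.
Proof. exact: (projT2 (cid (ex_proj_H4 h))). Qed.

Lemma projB_sub E F P' (EP : range E `<=` range P') :
  range F `<=` range P' -> (forall x, range F x -> E x = 0) ->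
  range F `<=` range (projB EP).
Proof.
move=> FP FE x Fx; apply/range_projP => /=.
by rewrite FE// subr0; apply/range_projP/FP.
Qed.

Lemma range_capQ0 E (N : set H) x : range E = N `&` range Q -> Q x = 0 ->
  E x = 0.
Proof.
move=> EN Qx; apply: inner_inj => y; rewrite inner0r -projP.
have : range E (E y) by exists y.
by rewrite EN => -[_ /range_projP <-]; rewrite projP Qx inner0r.
Qed.

Lemma P1_sub : range P1 `<=` range P.
Proof. by rewrite range_P1 => x []. Qed.

Lemma P2_sub : range P2 `<=` range (projB P1_sub).
Proof.
apply: projB_sub => x; rewrite range_P2 => -[Px /= Qx]; first exact: Px.
exact: (range_capQ0 range_P1 Qx).
Qed.

Lemma P3_sub : range P3 `<=` range (projC P).
Proof. by rewrite range_P3 range_projC => x []. Qed.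

Lemma P4_sub : range P4 `<=` range (projB P3_sub).
Proof.
apply: projB_sub => x; rewrite range_P4 => -[Px /= Qx].
  by apply/(range_projP (projC P)); rewrite /= Px subr0.
exact: (range_capQ0 range_P3 Qx).
Qed.

Definition P5 : projection H := projB P2_sub.
Definition P6 : projection H := projB P4_sub.

Lemma P5E : proj_op P5 = proj_op P - proj_op P1 - proj_op P2. Proof. by []. Qed.
Lemma P6E : proj_op P6 = (aid H - proj_op P) - proj_op P3 - proj_op P4. Proof. by []. Qed.

End Pieces.

Lemma corner_subproof E F (T : adjointable H H) (x : rng F) (y : rng E) :
  inner (to_rng E (T (F (val x)))) y
  = inner x (to_rng F (adj T (E (val y)))) :> A.
Proof.
change (inner (E (T (F (val x)))) (val y)
        = inner (val x) (F (adj T (E (val y)))) :> A).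
by rewrite projP adjP projP.
Qed.

(* E T F restricted to R(F), as an operator from R(F) to R(E). *)
Definition corner E (T : adjointable H H) F : adjointable (rng F) (rng E) :=
  Adjointable (@corner_subproof E F T).

Lemma cornerE E T F (x : rng F) :
  val (corner E T F x) = (E \oA T \oA F) (val x).
Proof. by []. Qed.

End Harmonious.

(* Main.v *)
(* Put S = P5 Q P6 : H6 -> H5 and Q6 = P6 Q P6. As Q leaves H5 + H6 invariant,
   Q^2 = Q reads S S^* = Q0 (1 - Q0), S^* S = Q6 (1 - Q6) and
   Q6 S^* = S^* (1 - Q0). Harmony says that P5 Q, P5 (1 - Q), P6 Q and
   P6 (1 - Q) have dense ranges in H5, resp. H6, hence so do Q0, 1 - Q0, Q6 and
   1 - Q6, since T and T T^* have the same closed range. So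
   G = Q0^(1/2) (1 - Q0)^(1/2) and S^* have dense ranges, and G^2 = S S^* makes
   G x |-> S^* x extend to a unitary V; take U0 = V^*.
   Contractivity of projections and uniqueness of square roots amount to
   |a| <= |a + b| for a = x^* x, b = y^* y in A, which is derived from
   Kaplansky's theorem that x^* x is positive; the only functional calculus
   used is the square root, obtained by iteration. *)
From HB Require Import structures.
Require Import Defs.
From mathcomp Require Import all_boot all_order all_algebra complex.
From mathcomp Require Import ring lra.
From mathcomp Require Import boolp classical_sets functions reals topology.
From mathcomp Require Import normedtype.

Set Implicit Arguments.
Unset Strict Implicit.
Unset Printing Implicit Defensive.

Import Order.TTheory GRing.Theory Num.Theory.
Import numFieldNormedType.Exports.

Local Open Scope classical_set_scope.
Local Open Scope ring_scope.

(** Before positivity in [A] is understood, a Hilbert module only offers a crude Cauchy-Schwarz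
    inequality with constant 4, too weak to compare [T] sharply with [adj T \oA T]. The circle is
    broken by running Kaplansky's argument on [A] as a module over itself, where the sharp
    inequality follows from submultiplicativity and [|a^*| = |a|]. Operators on that module also
    have the unit that [A] may lack. What returns to [H] is monotonicity of the norm on positive
    elements; from then on remainders are exhibited as sums of inner products [<y, y>], so that no
    order on [A] has to be developed. Limits carry an explicit rate [c / (n + 1)], written with
    [*+ n.+1], so that identities pass to the limit by the triangle inequality and the Archimedean
    property. *)

(** * The complex algebra of adjointable operators *)

Section OperatorAlgebra.
Variables (R : realType) (A : cstarAlgType R).
Implicit Types H K L M : innerModType A.

Lemma ascale_subproof H K (l : R[i]) (T : adjointable H K) x y :
  inner (l *: T x) y = inner x (l^* *: adj T y).
Proof. by rewrite innerZl innerZr adjP. Qed.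
Definition ascale H K (l : R[i]) (T : adjointable H K) : adjointable H K :=
  Adjointable (ascale_subproof l T).

Lemma ascaleA H K (a b : R[i]) (T : adjointable H K) :
  ascale a (ascale b T) = ascale (a * b) T.
Proof. by apply: adjointable_eq => x /=; rewrite scalerA. Qed.
Lemma ascale1 H K : left_id 1 (@ascale H K).
Proof. by move=> T; apply: adjointable_eq => x /=; rewrite scale1r. Qed.
Lemma ascaleDr H K : right_distributive (@ascale H K) +%R.
Proof. by move=> a S T; apply: adjointable_eq => x /=; rewrite scalerDr. Qed.
Lemma ascaleDl H K (T : adjointable H K) :
  {morph (@ascale H K)^~ T : a b / a + b}.
Proof. by move=> a b; apply: adjointable_eq => x /=; rewrite scalerDl. Qed.

HB.instance Definition _ H K := GRing.Zmodule_isLmodule.Build R[i]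
  (adjointable H K) (@ascaleA H K) (@ascale1 H K) (@ascaleDr H K) (@ascaleDl H K).

Lemma acomp_assoc H K L M (S : adjointable L M) (T : adjointable K L)
  (U : adjointable H K) : S \oA (T \oA U) = S \oA T \oA U.
Proof. exact: adjointable_eq. Qed.
Lemma acomp1l H : left_id (aid H) (@acomp _ _ H H H).
Proof. by move=> S; exact: adjointable_eq. Qed.
Lemma acomp1r H : right_id (aid H) (@acomp _ _ H H H).
Proof. by move=> S; exact: adjointable_eq. Qed.
Lemma acompDl H : left_distributive (@acomp _ _ H H H) +%R.
Proof. by move=> S T U; exact: adjointable_eq. Qed.
Lemma acompDr H : right_distributive (@acomp _ _ H H H) +%R.
Proof. by move=> S T U; apply: adjointable_eq => x /=; rewrite aopD. Qed.

HB.instance Definition _ H := GRing.Zmodule_isPzRing.Build (adjointable H H)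
  (@acomp_assoc H H H H) (@acomp1l H) (@acomp1r H) (@acompDl H) (@acompDr H).

Lemma aopDE H K (S T : adjointable H K) x : (S + T) x = S x + T x.
Proof. by []. Qed.
Lemma aopNE H K (T : adjointable H K) x : (- T) x = - T x.
Proof. by []. Qed.
Lemma aopZE H K l (T : adjointable H K) x : (l *: T) x = l *: T x.
Proof. by []. Qed.
Lemma aopME H (S T : adjointable H H) x : (S * T) x = S (T x).
Proof. by []. Qed.
Lemma aop1E H (x : H) : (1 : adjointable H H) x = x.
Proof. by []. Qed.

Lemma adj_add H K (S T : adjointable H K) : adj (S + T) = adj S + adj T.
Proof. exact: adjointable_eq. Qed.
Lemma adj_sub H K (S T : adjointable H K) : adj (S - T) = adj S - adj T.
Proof. exact: adjointable_eq. Qed.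
Lemma adj_scale H K l (T : adjointable H K) : adj (l *: T) = l^* *: adj T.
Proof. exact: adjointable_eq. Qed.
Lemma adj_one H : adj (1 : adjointable H H) = 1.
Proof. exact: adjointable_eq. Qed.
Lemma adj_mul H (S T : adjointable H H) : adj (S * T) = adj T * adj S.
Proof. exact: adjointable_eq. Qed.
Lemma adj_comp H K L (S : adjointable K L) (T : adjointable H K) :
  adj (S \oA T) = adj T \oA adj S.
Proof. exact: adjointable_eq. Qed.

Lemma aopZl H l (S T : adjointable H H) : (l *: S) * T = l *: (S * T).
Proof. exact: adjointable_eq. Qed.
Lemma aopZr H l (S T : adjointable H H) : S * (l *: T) = l *: (S * T).
Proof. by apply: adjointable_eq => x /=; rewrite aopZ. Qed.

End OperatorAlgebra.

(** * Limits with an explicit rate *)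

Section Limits.
Variables (R : realType) (A : cstarAlgType R).
Implicit Types H : hilbertModType A.

Lemma ge0_complex (z : R[i]) : 0 <= z -> exists2 u : R, 0 <= u & z = u%:C%C.
Proof.
by case: z => a b; rewrite lecE /= => /andP[/eqP -> a0]; exists a.
Qed.

(** Archimedean property: if [x > y], the multiples of [x - y] would exceed [c]. *)
Lemma le_of_mulrn_le (x y c : R[i]) :
  0 <= x -> 0 <= y -> (forall n, x *+ n.+1 <= y *+ n.+1 + c) -> x <= y.
Proof.
move=> x0 y0 xyc.
(* The case [n = 0] gives [0 <= y + c], which in [R[i]] already forces [c] to be real. *)
have c_real : c \is Num.real.
  rewrite -(addKr (y *+ 1) c) rpredD ?rpredN ?ger0_real//.
  by rewrite (le_trans _ (xyc 0%N)).
have [[u u0 ux] [v v0 vy]] := (ge0_complex x0, ge0_complex y0).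
have [w wc] := complex_realP _ c_real.
move: xyc; rewrite {x0 y0 c_real}ux vy wc => xyc; rewrite lecR leNgt.
apply/negP => vu; have := xyc (Num.truncn (w / (u - v))).
rewrite -!rmorphMn -rmorphD lecR leNgt => /negP; apply.
rewrite addrC -ltrBrDr -mulrnBl -mulr_natl -ltr_pdivrMr ?subr_gt0//.
exact: truncnS_gt.
Qed.

Lemma eq0_of_mulrn_le (z c : R[i]) :
  0 <= z -> (forall n, z *+ n.+1 <= c) -> z = 0.
Proof.
move=> z0 zc; apply/le_anti; rewrite z0 andbT.
by apply: (@le_of_mulrn_le _ _ c) => // n; rewrite mul0rn add0r.
Qed.

(** The bound survives [m -> oo]. Handing the same rate to the limit lets later arguments avoid
    filters. *)
Lemma cvg_rate H (u : nat -> H) (c : R[i]) :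
  (forall n m, (n <= m)%N -> `|u m - u n| *+ n.+1 <= c) ->
  exists l, forall n, `|l - u n| *+ n.+1 <= c.
Proof.
move=> uc.
have c0 : 0 <= c by rewrite (le_trans _ (uc 0%N 0%N _))// mulrn_wge0.
have small e : 0 < e -> exists n : nat, forall m, (n <= m)%N -> `|u m - u n| < e.
  move=> e0; have [v v0 vc] := ge0_complex c0.
  have [w w0 we] := ge0_complex (ltW e0).
  move: e0; rewrite we ltcR => {}w0.
  exists (Num.truncn (v / w)) => m nm.
  set n := Num.truncn _ in nm *; have n0 : (0 : R[i]) < n.+1%:R by rewrite ltr0n.
  rewrite -(ltr_pM2r n0) mulr_natr (le_lt_trans (uc _ _ nm))// vc mulr_natr.
  by rewrite -rmorphMn ltcR -mulr_natl -ltr_pdivrMr// truncnS_gt.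
have /cauchy_cvg/cvg_ex[l ul] : cauchy (u @ \oo).
  apply: cauchy_exP => e e0; have [n nP] := small _ e0.
  exists (u n); exists n => // k /= nk; rewrite -ball_normE /= distrC.
  exact: nP.
exists l => n; apply/ler_addgt0Pr => e e0.
have n0 : (0 : R[i]) < n.+1%:R by rewrite ltr0n.
have [m [mn lm]] : exists m, (n <= m)%N /\ `|l - u m| < e / n.+1%:R.
  move/cvgrPdist_lt : ul => /(_ _ (divr_gt0 e0 n0)) [k _ kP].
  by exists (maxn n k); rewrite leq_maxl; split => //; apply: kP; exact: leq_maxr.
move: lm; rewrite ltr_pdivlMr// mulr_natr => /ltW lm.
rewrite -(subrK (u m) l) -addrA addrC.
by rewrite (le_trans (ler_wMn2r _ (ler_normD _ _)))// mulrnDl lerD// uc.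
Qed.

Lemma inner_rate_l H n (x y : H) c :
  `|x| *+ n <= c -> `|inner x y : A| *+ n <= 4 * (c * `|y|).
Proof.
move=> xc; rewrite (le_trans (ler_wMn2r _ (inner_bound _ _)))//.
by rewrite -mulrnAr -mulrnAl ler_wpM2l// ler_wpM2r.
Qed.

Lemma inner_rate_r H n (x y : H) c :
  `|y| *+ n <= c -> `|inner x y : A| *+ n <= 4 * (`|x| * c).
Proof.
move=> xc; rewrite (le_trans (ler_wMn2r _ (inner_bound _ _)))//.
by rewrite -!mulrnAr ler_wpM2l// ler_wpM2l.
Qed.

(** How identities pass to the limit: both sides are compared with the same approximant [t], and the
    errors add up to a rate for [|a - b|]. *)
Lemma eq_of_rate (V : normedModType R[i]) (a b : V) (c d : R[i]) :
  (forall n, exists2 t, `|a - t| *+ n.+1 <= c & `|b - t| *+ n.+1 <= d) ->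
  a = b.
Proof.
move=> ab; apply/eqP; rewrite -subr_eq0; apply/eqP/normr0_eq0.
apply: (@eq0_of_mulrn_le _ (c + d)) => // n; have [t at_ bt] := ab n.
rewrite (_ : a - b = (a - t) - (b - t)); last by rewrite opprB addrA addrNK.
by rewrite (le_trans (ler_wMn2r _ (ler_normB _ _)))// mulrnDl lerD.
Qed.

End Limits.

(** * Bounds of operators *)

Section Bounds.
Variables (R : realType) (A : cstarAlgType R).
Implicit Types H K L : hilbertModType A.

(** Stands in for the operator norm, whose supremum is never formed. *)
Definition op_bound H K (T : adjointable H K) (r : R[i]) : Prop :=
  forall x, `|T x| <= r * `|x|.

Lemma op_boundN H K (T : adjointable H K) r : op_bound T r -> op_bound (- T) r.
Proof. by move=> Tr x; rewrite aopNE normrN. Qed.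

Lemma op_boundD H K (S T : adjointable H K) r s :
  op_bound S r -> op_bound T s -> op_bound (S + T) (r + s).
Proof.
by move=> Sr Ts x; rewrite mulrDl (le_trans (ler_normD _ _))// lerD.
Qed.

Lemma op_boundB H K (S T : adjointable H K) r s :
  op_bound S r -> op_bound T s -> op_bound (S - T) (r + s).
Proof. by move=> Sr Ts; apply: op_boundD => //; exact: op_boundN. Qed.

Lemma op_boundZ H K (T : adjointable H K) l r :
  op_bound T r -> op_bound (l *: T) (`|l| * r).
Proof. by move=> Tr x; rewrite aopZE normrZ -mulrA ler_wpM2l. Qed.

Lemma op_bound_comp H K L (S : adjointable K L) (T : adjointable H K) r s :
  0 <= r -> op_bound S r -> op_bound T s -> op_bound (S \oA T) (r * s).
Proof.
move=> r0 Sr Ts x; rewrite /= (le_trans (Sr _))// -mulrA ler_wpM2l//.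
Qed.

Lemma op_boundM H (S T : adjointable H H) r s :
  0 <= r -> op_bound S r -> op_bound T s -> op_bound (S * T) (r * s).
Proof. exact: op_bound_comp. Qed.

Lemma op_bound_scalar H (r : R[i]) :
  0 <= r -> op_bound (r *: (1 : adjointable H H)) r.
Proof. by move=> r0 x; rewrite aopZE normrZ ger0_norm. Qed.

Lemma op_bound_le H K (T : adjointable H K) r s :
  r <= s -> op_bound T r -> op_bound T s.
Proof. by move=> rs Tr x; rewrite (le_trans (Tr x))// ler_wpM2r. Qed.

Lemma op_bound0 H K (T : adjointable H K) : op_bound T 0 -> T = 0.
Proof.
move=> T0; apply: adjointable_eq => x; apply/normr0_eq0/le_anti.
by rewrite normr_ge0 andbT; have := T0 x; rewrite mul0r.
Qed.

End Bounds.

(* Iteration for the square root of [1 - X]: the limit [L] of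
   [Y_(n+1) = (X + Y_n ^ 2) / 2] satisfies [(1 - L) ^ 2 = 1 - X]. The increments
   of [Y_n] are dominated by those of the scalar sequence obtained for [X = 1]. *)
Section SqrtIteration.
Variables (R : realType) (A : cstarAlgType R) (H : hilbertModType A).
Variable X : adjointable H H.
Hypotheses (Xadj : adj X = X) (X1 : op_bound X 1).

Fixpoint scalar_iter n : R :=
  if n is m.+1 then (1 + scalar_iter m ^+ 2) / 2 else 0.

(** The defect [d_n = 1 - y_n] obeys [d_(n+1) = d_n - d_n^2 / 2], so it decays like [2 / n]. The
    shift to [n + 2] makes the case [n = 0] an equality. *)
Lemma scalar_iter_bounds n :
  0 <= scalar_iter n <= 1 /\ (1 - scalar_iter n) * n.+2%:R <= 2.
Proof.
elim: n => [|n [/andP[y0 y1] yn]]; first by rewrite /= lexx ler01 subr0 mul1r.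
set y := scalar_iter n in y0 y1 yn *; rewrite /= -/y.
have -> : n.+3%:R = n%:R + 3 :> R by rewrite -addn3 natrD.
move: yn; have -> : n.+2%:R = n%:R + 2 :> R by rewrite -addn2 natrD.
have : 0 <= n%:R :> R by rewrite ler0n.
move: (n%:R) => t t0 yn; split; first by apply/andP; split; nra.
have e0 : (0 : R) < (t + 2) ^+ 2 by nra.
rewrite -(ler_pM2l e0).
have -> : (t + 2) ^+ 2 * ((1 - (1 + y ^+ 2) / 2) * (t + 3))
  = ((1 - y) * (t + 2) * (2 * (t + 2) - (1 - y) * (t + 2)) / 2) * (t + 3).
  by field.
set d := (1 - y) * (t + 2) in yn *.
have d0 : 0 <= d by rewrite /d; nra.
(* The left side increases in [d] up to [t + 2 >= 2], and [d <= 2] gives its largest value. What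
   remains is [(t + 1)(t + 3) <= (t + 2)^2]. *)
have : d * (2 * (t + 2) - d) <= 4 * (t + 1) by nra.
by nra.
Qed.

Lemma scalar_iter_ge0 n : 0 <= scalar_iter n.
Proof. by have [/andP[]] := scalar_iter_bounds n. Qed.

Lemma scalar_iter_le1 n : scalar_iter n <= 1.
Proof. by have [/andP[]] := scalar_iter_bounds n. Qed.

Fixpoint op_iter n : adjointable H H :=
  if n is m.+1 then 2^-1 *: (X + op_iter m * op_iter m) else 0.

Lemma op_iter_comm Z : GRing.comm Z X -> forall n, GRing.comm Z (op_iter n).
Proof.
move=> ZX; elim=> [|n IH] /=; first exact: commr0.
rewrite /GRing.comm aopZl aopZr; congr (_ *: _).
by apply: commrD => //; exact: commrM.
Qed.

Lemma op_iter_adj n : adj (op_iter n) = op_iter n.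
Proof.
elim: n => [|n IH] /=; first exact: adjointable_eq.
rewrite adj_scale adj_add adj_mul Xadj !IH rmorphV ?unitfE ?pnatr_eq0//=.
by rewrite rmorph_nat.
Qed.

Lemma half_ge0 : (0 : R[i]) <= 2^-1. Proof. by rewrite invr_ge0. Qed.

Lemma op_iter_bound n : op_bound (op_iter n) (scalar_iter n)%:C%C.
Proof.
have y0 n' : 0 <= (scalar_iter n')%:C%C :> R[i].
  by rewrite ler0c scalar_iter_ge0.
elim: n => [|n IH] /=; first by move=> x; rewrite normr0 mulr_ge0.
have := op_boundZ 2^-1 (op_boundD X1 (op_boundM (y0 n) IH IH)).
apply: op_bound_le; rewrite ger0_norm ?half_ge0//.
by rewrite rmorphM rmorphD rmorphXn fmorphV rmorph_nat rmorph1 mulrC.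
Qed.

Lemma op_iter_step n :
  op_bound (op_iter n.+1 - op_iter n) (scalar_iter n.+1 - scalar_iter n)%:C%C.
Proof.
elim: n => [|n IH].
  rewrite /= subr0 mul0r addr0 subr0 expr0n addr0.
  have := op_boundZ 2^-1 X1; apply: op_bound_le.
  by rewrite ger0_norm ?half_ge0// mulr1 mul1r fmorphV rmorph_nat.
(* Factoring the difference of squares requires the iterates to commute; they do, being polynomials
   in [X]. *)
have e : op_iter n.+2 - op_iter n.+1
    = 2^-1 *: ((op_iter n.+1 - op_iter n) * (op_iter n.+1 + op_iter n)).
  rewrite [op_iter n.+2]/= [X in _ - X]/= -scalerBr; congr (_ *: _).
  rewrite mulrDr !mulrBl (op_iter_comm (esym (op_iter_comm (erefl (X * X)) n)) n.+1).
  by rewrite opprD addrACA subrr add0r addrA addrNK.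
rewrite e; have := op_boundZ 2^-1 (op_boundM _ IH
  (op_boundD (op_iter_bound n.+1) (op_iter_bound n))).
have s0 : 0 <= (scalar_iter n.+1 - scalar_iter n)%:C%C :> R[i].
  rewrite ler0c /=; have := scalar_iter_le1 n; have := scalar_iter_ge0 n.
  by nra.
move=> /(_ s0); apply: op_bound_le; rewrite ger0_norm ?half_ge0//.
have -> : 2^-1 = (2^-1 : R)%:C%C by rewrite fmorphV rmorph_nat.
rewrite -rmorphD -!rmorphM lecR /= le_eqVlt; apply/orP; left.
by apply/eqP; field.
Qed.

Lemma op_iter_cauchy n m : (n <= m)%N ->
  op_bound (op_iter m - op_iter n) (scalar_iter m - scalar_iter n)%:C%C.
Proof.
move=> /subnK <-; elim: (m - n)%N => [|k IH].
  by rewrite add0n !subrr => x; rewrite normr0 mul0r.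
have := op_boundD (op_iter_step (k + n)) IH.
by rewrite -rmorphD !addrA !addrNK.
Qed.

Lemma op_iter_rate n m x : (n <= m)%N ->
  `|op_iter m x - op_iter n x| *+ n.+1 <= 2 * `|x|.
Proof.
move=> nm.
rewrite (le_trans (ler_wMn2r _ (op_iter_cauchy nm x)))// -mulrnAl.
rewrite ler_wpM2r// -rmorphMn -(rmorph_nat (real_complex R) 2) lecR.
have [_] := scalar_iter_bounds n; have := scalar_iter_le1 m.
have := scalar_iter_le1 n.
rewrite -[(_ - _) *+ n.+1]mulr_natr -addn2 -[n.+1]addn1 !natrD.
have : 0 <= n%:R :> R by rewrite ler0n.
move: (n%:R) => t; set a := scalar_iter n; set b := scalar_iter m.
move=> t0 a1 b1 at2; nra.
Qed.

Lemma ex_op_lim x :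
  exists l, forall n, `|l - op_iter n x| *+ n.+1 <= 2 * `|x|.
Proof. by apply: cvg_rate => n m; exact: op_iter_rate. Qed.

Definition op_lim x : H := projT1 (cid (ex_op_lim x)).

Lemma op_limP x n : `|op_lim x - op_iter n x| *+ n.+1 <= 2 * `|x|.
Proof. exact: (projT2 (cid (ex_op_lim x))). Qed.

Lemma op_lim_adj_subproof x y : inner (op_lim x) y = inner x (op_lim y).
Proof.
apply: (@eq_of_rate R A _ _ (4 * (2 * `|x| * `|y|)) (4 * (`|x| * (2 * `|y|)))) => n.
exists (inner (op_iter n x) y).
  by rewrite -innerBl inner_rate_l// op_limP.
by rewrite adjP op_iter_adj -innerBr inner_rate_r// op_limP.
Qed.

Definition aop_lim := Adjointable op_lim_adj_subproof.

Lemma aop_lim_bound : op_bound aop_lim 1.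
Proof.
move=> x; rewrite mul1r; apply: (@le_of_mulrn_le _ _ _ (2 * `|x|)) => // n.
rewrite -(addrNK (op_iter n x) (aop_lim x)).
rewrite (le_trans (ler_wMn2r _ (ler_normD _ _)))// mulrnDl addrC lerD//.
  rewrite ler_wMn2r// (le_trans (op_iter_bound n x))// -[leRHS]mul1r.
  by rewrite ler_wpM2r// -(rmorph1 (real_complex R)) lecR scalar_iter_le1.
exact: op_limP.
Qed.

Lemma aop_lim_comm Z : GRing.comm Z X -> GRing.comm Z aop_lim.
Proof.
move=> ZX; apply: adjointable_eq => x; apply: inner_inj => y.
rewrite !aopME -[inner y (Z _)]adj_subproof.
apply: (@eq_of_rate R A _ _ (4 * (`|adj Z y| * (2 * `|x|)))
                      (4 * (`|y| * (2 * `|Z x|)))) => n.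
exists (inner y (Z (op_iter n x))).
  by rewrite -[inner y (Z _)]adj_subproof -innerBr inner_rate_r// op_limP.
rewrite -[Z (op_iter n x)]aopME (op_iter_comm ZX) -innerBr inner_rate_r//.
exact: op_limP.
Qed.

Lemma aop_limE : 2 *: aop_lim = X + aop_lim * aop_lim.
Proof.
apply: adjointable_eq => x; rewrite aopZE aopDE aopME.
apply: (@eq_of_rate R H _ _ (2 * (2 * `|x|)) (2 * `|x| + 2 * `|x|)) => n.
exists (2 *: op_iter n.+1 x).
  rewrite -scalerBr normrZ normr_nat -mulrnAr ler_wpM2l//.
  rewrite (le_trans _ (op_limP x n.+1))//.
  by rewrite [leRHS]mulrS lerDr.
rewrite /= scalerA mulfV ?pnatr_eq0// scale1r.
rewrite opprD addrACA subrr add0r.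
(* With [L] the limit and [Y] the iterate, [L L x - Y Y x] is split at [L Y x]: the first half uses
   that [L] is a contraction, the second the rate at the point [Y x]. *)
rewrite -(addrNK (op_lim (op_iter n x)) (op_lim (op_lim x))) -addrA.
rewrite -[op_lim (op_lim x)]/(aop_lim (op_lim x)).
rewrite -[in X in X + _](_ : aop_lim (op_iter n x) = op_lim (op_iter n x))//.
rewrite -aopB (le_trans (ler_wMn2r _ (ler_normD _ _)))// mulrnDl lerD//.
  rewrite (le_trans _ (op_limP x n))// ler_wMn2r//.
  by rewrite -[leRHS]mul1r aop_lim_bound.
rewrite (le_trans (op_limP _ _))// ler_wpM2l//.
rewrite (le_trans (op_iter_bound n x))// -[leRHS]mul1r.
by rewrite ler_wpM2r// -(rmorph1 (real_complex R)) lecR scalar_iter_le1.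
Qed.

(** With [D = 1 - L], the equation [2 L = X + L^2] rearranges to [D^2 = 1 - X]. The bound on [1 - D]
    encodes positivity of the root; the last clause records that it is a limit of polynomials in
    [X]. *)
Lemma ex_sqrt_contraction : exists D : adjointable H H,
  [/\ adj D = D, D * D = 1 - X, op_bound (1 - D) 1 &
      forall Z, GRing.comm Z X -> GRing.comm Z D].
Proof.
exists (1 - aop_lim); split.
- by rewrite adj_sub adj_one; congr (_ - _); exact: adjointable_eq.
- have LL : aop_lim * aop_lim - aop_lim = aop_lim - X.
    apply/eqP; rewrite subr_eq addrAC eq_sym subr_eq addrC -aop_limE.
    by rewrite scaler_nat mulr2n.
  by rewrite mulrBl mul1r mulrBr mulr1 opprB LL addrA addrNK.
- rewrite opprB addrC addrNK; exact: aop_lim_bound.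
- move=> Z ZX; apply: commrB; [exact: commr1|exact: aop_lim_comm].
Qed.

End SqrtIteration.

(** * Positivity expressed by norm bounds *)

Section PositiveBounds.
Variables (R : realType) (A : cstarAlgType R).
Implicit Types (H : hilbertModType A) (l r s t : R[i]).

(* For self-adjoint [T], [op_bound (r - T) r] says that the spectrum of [T]
   lies in [0, 2r]; this expresses positivity without spectral theory. *)
Definition pos_bound H (T : adjointable H H) (r : R[i]) : Prop :=
  [/\ 0 <= r, adj T = T & op_bound (r *: (1 : adjointable H H) - T) r].

Lemma conj_ge0 (r : R[i]) : 0 <= r -> r^* = r.
Proof. by move=> r0; rewrite conj_Creal// ger0_real. Qed.

Lemma adj_scale_ge0 (H K : innerModType A) (r : R[i]) (T : adjointable H K) :
  0 <= r -> adj (r *: T) = r *: adj T.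
Proof. by move=> r0; rewrite adj_scale conj_ge0. Qed.

Lemma comm_scale (H : innerModType A) (l : R[i]) (S T : adjointable H H) :
  GRing.comm S T -> GRing.comm S (l *: T).
Proof. by move=> ST; rewrite /GRing.comm aopZl aopZr ST. Qed.

Lemma adj_comm (H : innerModType A) (S T : adjointable H H) :
  adj S = S -> adj T = T -> GRing.comm S T -> adj (S * T) = S * T.
Proof. by move=> Sa Ta ST; rewrite adj_mul Sa Ta. Qed.

Lemma pos_boundD H (S T : adjointable H H) r s :
  pos_bound S r -> pos_bound T s -> pos_bound (S + T) (r + s).
Proof.
move=> [r0 Sa Sr] [s0 Ta Ts]; split; first exact: addr_ge0.
  by rewrite adj_add Sa Ta.
by rewrite scalerDl opprD addrACA; exact: op_boundD.
Qed.

Lemma pos_boundZ H (T : adjointable H H) l r :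
  0 <= l -> pos_bound T r -> pos_bound (l *: T) (l * r).
Proof.
move=> l0 [r0 Ta Tr]; split; first exact: mulr_ge0.
  by rewrite adj_scale_ge0// Ta.
rewrite -scalerA -scalerBr -[X in X * r](ger0_norm l0); exact: op_boundZ.
Qed.

Lemma pos_bound_op H (T : adjointable H H) r :
  pos_bound T r -> op_bound T (r + r).
Proof.
move=> [r0 _ Tr]; have := op_boundB (op_bound_scalar (H := H) r0) Tr.
by rewrite opprB addrC addrNK.
Qed.

Lemma pos_bound_sub H (T : adjointable H H) t :
  0 <= t -> adj T = T -> op_bound T t ->
  pos_bound (t *: (1 : adjointable H H) - T) t.
Proof.
move=> t0 Ta Tt; split=> //; last by rewrite opprB addrC addrNK.
by rewrite adj_sub adj_scale_ge0// adj_one Ta.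
Qed.

(** For [r > 0], [X = 1 - T / r] is a contraction, so the iteration gives a root of [T / r], to be
    rescaled by [sqrtC r]. For [r = 0] the bound forces [T = 0]. *)
Lemma ex_sqrt H (T : adjointable H H) r : pos_bound T r ->
  exists D, [/\ pos_bound D (sqrtC r), D * D = T &
               forall Z, GRing.comm Z T -> GRing.comm Z D].
Proof.
move=> [r0 Ta Tr].
have [re|rn] := eqVneq r 0.
  exists 0; rewrite re sqrtC0; split; last by move=> *; exact: commr0.
    split=> //; first exact: adjointable_eq.
    by move=> x; rewrite scale0r subr0 normr0 mul0r.
  rewrite mul0r; apply/eqP; rewrite eq_sym -oppr_eq0; apply/eqP/op_bound0.
  by move: Tr; rewrite re scale0r sub0r.
have rV0 : 0 <= r^-1 by rewrite invr_ge0.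
have s0 : 0 <= sqrtC r by rewrite sqrtC_ge0.
have Xa : adj (1 - r^-1 *: T) = 1 - r^-1 *: T.
  by rewrite adj_sub adj_one adj_scale_ge0// Ta.
have X1 : op_bound (1 - r^-1 *: T) 1.
  have := op_boundZ r^-1 Tr; rewrite scalerBr scalerA mulVf// scale1r.
  by rewrite ger0_norm// mulVf.
have [D [Da DD D1 Dc]] := ex_sqrt_contraction Xa X1.
exists (sqrtC r *: D); split.
- split=> //; first by rewrite adj_scale_ge0// Da.
  rewrite -scalerBr -[X in op_bound _ X]mulr1.
  by rewrite -[X in op_bound _ (X * 1)](ger0_norm s0); exact: op_boundZ.
- rewrite aopZl aopZr scalerA -expr2 sqrtCK DD opprB addrC addrNK.
  by rewrite scalerA divff// scale1r.
- move=> Z ZT; apply/comm_scale/Dc/commrB; first exact: commr1.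
  exact: comm_scale.
Qed.

(* [D + iE] and [D - iE] are [s] times isometries, with half-sum [D]. *)
Lemma op_bound_sqr_add H (D E : adjointable H H) (s : R[i]) :
  0 <= s -> adj D = D -> adj E = E -> GRing.comm D E ->
  D * D + E * E = s ^+ 2 *: (1 : adjointable H H) -> op_bound D s.
Proof.
move=> s0 Da Ea DE sE x.
have key (l : R[i]) : l^* = - l -> l^* * l = 1 ->
    `|D x + l *: E x| = s * `|x|.
  move=> lc ll; apply/eqP; rewrite -(eqrXn2 (n := 2)) ?mulr_ge0//; apply/eqP.
  rewrite norm_inner exprMn norm_inner -[s ^+ 2]ger0_norm ?exprn_ge0// -normrZ.
  congr (`| _ |); rewrite innerDl !innerDr !innerZl !innerZr.
  have -> : inner (E x) (D x) = inner (D x) (E x) :> A.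
    by rewrite !adjP Da Ea -[D (E x)]aopME DE.
  rewrite scalerA ll scale1r lc scaleNr addrA -[_ + _ - _]addrA subrr addr0.
  by rewrite !adjP Da Ea -innerDr -innerZr -[D _ + E _]/((D * D + E * E) x) sE.
have ii : 'i^* * 'i = 1 :> R[i].
  by rewrite conjCi mulNr -expr2 sqrCi opprK.
have e : 2 *: D x = (D x + 'i *: E x) + (D x + - 'i *: E x).
  by rewrite scaleNr addrACA subrr addr0 scaler_nat mulr2n.
rewrite -(ler_pM2l (_ : 0 < 2 :> R[i]))// -[2 in leLHS]normr_nat -normrZ e.
rewrite (le_trans (ler_normD _ _))// !key ?mulr_natl ?mulr2n//.
- by rewrite rmorphN /= conjCi.
- by rewrite rmorphN /= mulrNN.
- by rewrite conjCi.
Qed.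

(** The triangle inequality only bounds [s^2 - D^2] by [2 s^2]. But its root [E] commutes with [D]
    and [D^2 + E^2 = s^2], so [E] is bounded by [s] and [s^2 - D^2 = E^2] by [s^2]. *)
Lemma pos_bound_sqr H (D : adjointable H H) s :
  0 <= s -> adj D = D -> op_bound D s -> pos_bound (D * D) (s ^+ 2).
Proof.
move=> s0 Da Ds.
have DDa : adj (D * D) = D * D by rewrite adj_mul Da.
split=> //; first exact: exprn_ge0.
have := pos_bound_sub (exprn_ge0 2 s0) DDa (op_boundM s0 Ds Ds).
move=> /ex_sqrt[E [[t0 Ea _] EE Ec]].
have Es : op_bound E s.
  apply: (op_bound_sqr_add (E := D)) => //; last by rewrite EE addrNK.
  apply/esym/Ec/commrB; first exact/comm_scale/commr1.
  exact: commrM.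
by rewrite -EE expr2; exact: op_boundM.
Qed.

(** As a sum of the positive operators [t - (T + U)] and [U], [t - T] has a root [E]. If [D] is the
    root of [T], then [D^2 + E^2 = t] bounds [D] by [sqrtC t]. *)
Lemma op_bound_add_pos H (T U : adjointable H H) r s t :
  0 <= t -> pos_bound T r -> pos_bound U s -> op_bound (T + U) t ->
  op_bound T t.
Proof.
move=> t0 Tr Us TUt.
have [_ Ta _] := Tr; have [_ Ua _] := Us.
have TUa : adj (T + U) = T + U by rewrite adj_add Ta Ua.
have := pos_boundD (pos_bound_sub t0 TUa TUt) Us.
rewrite opprD addrA addrNK => /ex_sqrt[E [[_ Ea _] EE Ec]].
have [D [[_ Da _] DD Dc]] := ex_sqrt Tr.
have s0 : 0 <= sqrtC t by rewrite sqrtC_ge0.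
have Ds : op_bound D (sqrtC t).
  apply: (op_bound_sqr_add (E := E)) => //; last first.
    by rewrite DD EE sqrtCK [LHS]addrC addrNK.
  apply/Ec/commrB; first exact/comm_scale/commr1.
  by apply/esym/Dc.
by rewrite -DD -(sqrtCK t) expr2; exact: op_boundM.
Qed.

End PositiveBounds.

(** * Consequences of the sharp Cauchy-Schwarz inequality *)

Section CauchySchwarz.
Variables (R : realType) (A : cstarAlgType R) (H : hilbertModType A).
Hypothesis CS : forall x y : H, `|inner x y : A| <= `|x| * `|y|.
Implicit Types (D T : adjointable H H) (r s t : R[i]).

Lemma op_bound_adjM T r :
  0 <= r -> op_bound (adj T * T) (r ^+ 2) -> op_bound T r.
Proof.
move=> r0 Tr x; rewrite -(ler_pXn2r (n := 2)) ?nnegrE ?mulr_ge0//.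
rewrite norm_inner adjP (le_trans (CS _ _))// exprMn [`|x| ^+ 2]expr2.
by rewrite mulrA [leRHS]mulrC ler_wpM2l//; exact: Tr.
Qed.

Lemma op_bound_sqr T r :
  0 <= r -> adj T = T -> op_bound (T * T) (r ^+ 2) -> op_bound T r.
Proof. by move=> r0 Ta; rewrite -{1}Ta; exact: op_bound_adjM. Qed.

Lemma op_bound_adj T r : 0 <= r -> op_bound T r -> op_bound (adj T) r.
Proof.
move=> r0 Tr x; have [->|y0] := eqVneq (adj T x) 0.
  by rewrite normr0 mulr_ge0.
have n0 : 0 < `|adj T x| by rewrite normr_gt0.
rewrite -(ler_pM2l n0) -expr2 norm_inner adj_subproof (le_trans (CS _ _))//.
by rewrite mulrC [leRHS]mulrCA mulrA ler_wpM2r.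
Qed.

(** The root [D] of [T] is bounded by [sqrtC t], so [pos_bound_sqr] applies to it. This lets the
    radius follow the norm when the contraction below is iterated. *)
Lemma pos_bound_le T r t :
  0 <= t -> pos_bound T r -> op_bound T t -> pos_bound T t.
Proof.
move=> t0 /ex_sqrt[D [[_ Da _] <- _]] Dt.
have s0 : 0 <= sqrtC t by rewrite sqrtC_ge0.
rewrite -(sqrtCK t); apply: pos_bound_sqr => //.
by apply: op_bound_sqr => //; rewrite sqrtCK.
Qed.

End CauchySchwarz.

(** * Kaplansky's theorem *)

Section Kaplansky.
Variables (R : realType) (A : cstarAlgType R) (H : hilbertModType A).
Hypothesis CS : forall x y : H, `|inner x y : A| <= `|x| * `|y|.
Implicit Types B C D E T U : adjointable H H.

Lemma sqrD_sub_sqrB (S : pzRingType) (a b : S) :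
  (a + b) * (a + b) - (a - b) * (a - b) = (a * b + b * a) *+ 2.
Proof.
have e1 : a + b - (a - b) = b *+ 2 by rewrite opprB addrC addrA addrNK mulr2n.
have e2 : a + b + (a - b) = a *+ 2 by rewrite addrACA subrr addr0 mulr2n.
rewrite [X in X - _]mulrDl [X in _ - X]mulrBl opprB [X in _ + X]addrC addrACA.
by rewrite -mulrBr -mulrDr e1 e2 !mulrnAr mulrnDl.
Qed.

Lemma op_bound_geom (H' K : hilbertModType A) (C : adjointable H' K) m :
  (forall n, op_bound C ((9 / 10) ^+ n * m)) -> C = 0.
Proof.
move=> Cm; apply: adjointable_eq => x; apply/normr0_eq0.
apply: (@eq0_of_mulrn_le _ _ (10 * (m * `|x|))) => // n.
have mx0 : 0 <= m * `|x| by have := Cm 0%N x; rewrite mul1r; exact: le_trans.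
rewrite (le_trans (ler_wMn2r _ (Cm n x)))// -mulrA -mulrnAl ler_wpM2r//.
have -> : 9 / 10 = (9 / 10 : R)%:C%C by rewrite fmorph_div !rmorph_nat.
rewrite -rmorphXn -rmorphMn -(rmorph_nat (real_complex R) 10) lecR.
(* The shift by 10 makes the induction step [(9 / 10) (n + 11) <= n + 10] hold from the start. *)
have e : (9 / 10 : R) ^+ n * (n%:R + 10) <= 10.
  elim: n => [|n IH]; first by rewrite mul1r add0r.
  rewrite (le_trans _ IH)// exprSr -mulrA ler_wpM2l ?exprn_ge0 ?divr_ge0//.
  rewrite -[n.+1]addn1 natrD; have : 0 <= n%:R :> R by rewrite ler0n.
  by move: (n%:R) => t; lra.
rewrite (le_trans _ e)// -mulr_natr ler_wpM2l ?exprn_ge0 ?divr_ge0//.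
by rewrite -[n.+1]addn1 natrD; lra.
Qed.

(** [C C^* + C^* C] is half the sum of the squares of the self-adjoint [F] and [K], twice the real
    and (up to sign) imaginary parts of [C]; subtracting [C^* C = - E^2] leaves a sum of squares. *)
Lemma pos_bound_mul_adj C E (m s : R[i]) : 0 <= m -> 0 <= s ->
  op_bound C m -> op_bound E s -> adj E = E -> adj C * C = - (E * E) ->
  exists r, pos_bound (C * adj C) r.
Proof.
move=> m0 s0 Cm Es Ea CE.
have Cm' := op_bound_adj CS m0 Cm.
pose F := C + adj C; pose K := 'i *: (C - adj C).
have Fa : adj F = F by rewrite adj_add adjK addrC.
have Ka : adj K = K.
  by rewrite adj_scale adj_sub adjK conjCi scaleNr -scalerN opprB.
have i1 : `|'i : R[i]| = 1 by exact: normCi.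
have mm0 : 0 <= m + m by exact: addr_ge0.
have Fm : op_bound F (m + m) by exact: op_boundD.
have Km : op_bound K (m + m).
  by have := op_boundZ 'i (op_boundB Cm Cm'); rewrite i1 mul1r.
have e : C * adj C = E * E + 2^-1 *: (F * F + K * K).
  have KK : K * K = - ((C - adj C) * (C - adj C)).
    by rewrite aopZl aopZr scalerA -expr2 sqrCi scaleN1r.
  rewrite KK sqrD_sub_sqrB CE -[(_ - _) *+ 2]scaler_nat scalerA.
  by rewrite mulVf ?pnatr_eq0// scale1r addrC addrNK.
have h0 : (0 : R[i]) <= 2^-1 by rewrite invr_ge0.
exists (s ^+ 2 + 2^-1 * ((m + m) ^+ 2 + (m + m) ^+ 2)).
rewrite e; apply: pos_boundD; first exact: pos_bound_sqr.
by apply: pos_boundZ => //; apply: pos_boundD; exact: pos_bound_sqr.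
Qed.

(* If [C^* C = - E^2 =: - p] then [q := C C^*] is positive and
   [C p = - q C], so [p (s^2 + p) = - C^* (s^2 - q) C] has norm at most [s^4],
   while [p (s^2 + p) >= 2 p^2] as [p <= s^2]. *)
Lemma adjM_neg_sqr_contract C E (s r : R[i]) : 0 <= s -> adj E = E ->
  op_bound C s -> pos_bound (C * adj C) r -> adj C * C = - (E * E) ->
  op_bound C (9 / 10 * s).
Proof.
move=> s0 Ea Cs qr CE; set p := E * E in CE *.
have ss0 : 0 <= s ^+ 2 by exact: exprn_ge0.
have Cs' := op_bound_adj CS s0 Cs.
have pa : adj p = p by rewrite adj_mul Ea.
have ps : op_bound p (s ^+ 2).
  rewrite -[p]opprK -CE expr2; apply: op_boundN; exact: op_boundM.
have Es : op_bound E s by exact: op_bound_sqr.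
have qs : pos_bound (C * adj C) (s ^+ 2).
  by apply: (pos_bound_le CS ss0 qr); rewrite expr2; exact: op_boundM.
pose ss := s ^+ 2 *: (1 : adjointable H H).
have Cp : C * (ss + p) = (ss - C * adj C) * C.
  rewrite /ss mulrDr mulrBl aopZl aopZr mul1r mulr1 -mulrA CE mulrN opprK.
  by [].
have up : op_bound (s ^+ 2 *: p + p * p) (s ^+ 2 * s ^+ 2).
  have -> : s ^+ 2 *: p + p * p = - (adj C * (C * (ss + p))).
    by rewrite mulrA CE mulNr opprK mulrDr aopZr mulr1.
  rewrite Cp; apply: op_boundN.
  have -> : s ^+ 2 * s ^+ 2 = s * (s ^+ 2 * s) by rewrite [RHS]mulrCA -[s * s]expr2.
  by apply: op_boundM => //; apply: op_boundM => //; have [] := qs.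
have [F [Fr FF Fc]] := ex_sqrt (pos_bound_sub ss0 pa ps).
have EF : GRing.comm E F.
  by apply/Fc/commrB; [exact/comm_scale/commr1 | exact: commrM].
have [t0 Fa _] := Fr.
(* With [F^2 = s^2 - p], this operator is [(F E)^2], and [F E] is self-adjoint because [E] and [F]
   commute. *)
have lo : pos_bound (s ^+ 2 *: p - p * p)
    (((sqrtC (s ^+ 2) + sqrtC (s ^+ 2)) * s) ^+ 2).
  have -> : s ^+ 2 *: p - p * p = (F * E) * (F * E).
    by rewrite mulrA -[F * E * F]mulrA EF mulrA FF -mulrA -/p mulrBl aopZl mul1r.
  have tt0 := addr_ge0 t0 t0.
  apply: pos_bound_sqr => //; first exact: mulr_ge0.
    by apply: adj_comm => //; exact/esym.
  by apply: op_boundM => //; exact: pos_bound_op.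
have pp : pos_bound (2 *: (p * p)) (2 * (s ^+ 2) ^+ 2).
  by apply: pos_boundZ => //; exact: pos_bound_sqr.
have pp2 : op_bound (2 *: (p * p)) (s ^+ 2 * s ^+ 2).
  apply: (op_bound_add_pos _ pp lo); first exact: mulr_ge0.
  by rewrite scaler_nat mulr2n addrC addrA addrNK.
(* Now [p^2] is bounded by [s^4 / 2], hence [C] by [2^(-1/4) s]. The constant 9/10 is a rational
   above [2^(-1/4)]: its fourth power is 0.6561. *)
have k0 : (0 : R[i]) <= 9 / 10 by rewrite divr_ge0.
apply: (op_bound_adjM CS); first exact: mulr_ge0.
rewrite CE; apply/op_boundN/(op_bound_sqr CS) => //.
  by rewrite exprn_ge0// mulr_ge0.
have := op_boundZ 2^-1 pp2; rewrite scalerA mulVf ?pnatr_eq0// scale1r.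
apply: op_bound_le; rewrite ger0_norm ?invr_ge0//.
have -> : 2^-1 = (2^-1 : R)%:C%C by rewrite fmorphV rmorph_nat.
have -> : 9 / 10 = (9 / 10 : R)%:C%C by rewrite fmorph_div !rmorph_nat.
set k := (9 / 10)%:C%C.
rewrite -[s ^+ 2 * _]expr2 [(k * s) ^+ 2]exprMn [(k ^+ 2 * _) ^+ 2]exprMn.
by rewrite ler_wpM2r ?exprn_ge0// -!rmorphXn lecR; lra.
Qed.

Lemma adjM_neg_sqr_eq0 C E (m s : R[i]) : 0 <= m -> 0 <= s ->
  op_bound C m -> op_bound E s -> adj E = E -> adj C * C = - (E * E) -> C = 0.
Proof.
move=> m0 s0 Cm Es Ea CE; have [r qr] := pos_bound_mul_adj m0 s0 Cm Es Ea CE.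
apply: (@op_bound_geom _ _ _ m); elim=> [|n IH]; first by rewrite mul1r.
rewrite exprS -mulrA; apply: adjM_neg_sqr_contract qr CE => //.
by rewrite mulr_ge0// exprn_ge0// divr_ge0.
Qed.

Lemma selfadj_sqr_eq0 E : adj E = E -> E * E = 0 -> E = 0.
Proof.
move=> Ea EE; apply/op_bound0/(op_bound_sqr CS) => //.
by rewrite EE => x; rewrite normr0 expr0n mul0r.
Qed.

(* Kaplansky: with [T := B^* B], [N := |T| - T] and [W := |T|^(1/2)], one has
   [(B N)^* (B N) = - (W N)^2], which forces [B N = 0] and then [T = |T|]. *)
Theorem pos_bound_adjM B (m : R[i]) : 0 <= m -> op_bound B m ->
  exists r, pos_bound (adj B * B) r.
Proof.
move=> m0 Bm; set T := adj B * B.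
have Ta : adj T = T by rewrite adj_mul adjK.
have mm0 : 0 <= m * m by exact: mulr_ge0.
have Tm : op_bound T (m * m) by apply: op_boundM => //; exact: op_bound_adj.
have [M [Mr MM Mc]] := ex_sqrt (pos_bound_sqr mm0 Ta Tm).
have [r0 Ma _] := Mr.
have TM : GRing.comm T M by apply/Mc/commrM.
have [W [Wr WW Wc]] := ex_sqrt Mr.
have [t0 Wa _] := Wr.
have TW : GRing.comm T W by exact: Wc.
have MW : GRing.comm W M by rewrite -WW; apply: commrM.
pose N := M - T.
have Na : adj N = N by rewrite adj_sub Ma Ta.
have WN : GRing.comm W N by apply: commrB => //; exact/esym.
(* [M] commutes with [T] and [M^2 = T^2], so [(T + M) (M - T) = 0]. *)
have MN : T * N = - (M * N).
  by rewrite /N !mulrBr TM MM opprB addrC.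
have Nb := op_boundB (pos_bound_op Mr) Tm.
have rr0 := addr_ge0 r0 r0; have tt0 := addr_ge0 t0 t0.
have nb0 := addr_ge0 rr0 mm0.
have CN : adj (B * N) * (B * N) = - ((W * N) * (W * N)).
  rewrite adj_mul Na mulrA -[N * adj B * B]mulrA -/T -mulrA MN mulrN.
  by congr (- _); rewrite -WW [X in _ = X * _]WN -!mulrA.
have C0 : B * N = 0.
  apply: (adjM_neg_sqr_eq0 (mulr_ge0 m0 nb0) (mulr_ge0 tt0 nb0) _ _ _ CN).
  - exact: op_boundM.
  - by apply: op_boundM => //; exact: pos_bound_op.
  - exact: adj_comm.
have WN0 : W * N = 0.
  apply: selfadj_sqr_eq0; first exact: adj_comm.
  by apply/eqP; rewrite -oppr_eq0 -CN C0 mulr0.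
have MN0 : M * N = 0 by rewrite -WW -mulrA WN0 mulr0.
have N0 : N = 0.
  apply: selfadj_sqr_eq0 => //.
  by rewrite {1}/N mulrBl MN MN0 oppr0 subr0.
by exists (sqrtC ((m * m) ^+ 2)); rewrite -[T](subrK M) -opprB -/N N0 oppr0 add0r.
Qed.

End Kaplansky.

(** * The algebra [A] as a Hilbert module over itself *)

Section SelfModule.
Variables (R : realType) (A : cstarAlgType R).

Definition selfmod : Type := A.

HB.instance Definition _ := CompleteNormedModule.copy selfmod A.

Lemma selfmod_nondeg (x : selfmod) :
  (forall y : selfmod, cmul (cstar (x : A)) (y : A) = 0) -> x = 0.
Proof.
move=> /(_ x) xx; apply/normr0_eq0/eqP; rewrite -sqrf_eq0.
by rewrite -[`|x|]/(`|x : A|) -cnorm_star xx normr0.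
Qed.

HB.instance Definition _ := isInnerModule.Build R A selfmod
  (ract := fun x a => cmul (x : A) a)
  (inner := fun x y => cmul (cstar (x : A)) (y : A))
  (fun x y a => cmulDl (x : A) y a) (fun x a b => cmulDr (x : A) a b)
  (fun x a b => cmulA (x : A) a b) (fun l x a => cmulZl l (x : A) a)
  (fun l x a => cmulZr l (x : A) a)
  (fun x y z => cmulDr (cstar (x : A)) y z)
  (fun l x y => cmulZr l (cstar (x : A)) y)
  (fun x y a => cmulA (cstar (x : A)) y a)
  (fun x y => etrans (cstarM (cstar (x : A)) y)
                     (f_equal (cmul (cstar (y : A))) (cstarK x)))
  selfmod_nondeg.

Lemma selfmod_ge0 (x : selfmod) : cpos (inner x x : A).
Proof. by exists (x : A). Qed.

Lemma selfmod_norm (x : selfmod) : `|x| ^+ 2 = `|inner x x : A|.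
Proof. exact/esym/cnorm_star. Qed.

HB.instance Definition _ :=
  isHilbertModule.Build R A selfmod selfmod_ge0 selfmod_norm.

Lemma selfmod_CS (x y : selfmod) : `|inner x y : A| <= `|x| * `|y|.
Proof. by rewrite (le_trans (cnormM _ _))// cstar_norm. Qed.

Lemma lmul_subproof (a : A) (x y : selfmod) :
  inner (cmul a x : selfmod) y = inner x (cmul (cstar a) y : selfmod).
Proof.
rewrite -[LHS]/(cmul (cstar (cmul a x)) y).
by rewrite -[RHS]/(cmul (cstar (x : A)) (cmul (cstar a) y)) cstarM cmulA.
Qed.

Definition lmul (a : A) : adjointable selfmod selfmod :=
  Adjointable (lmul_subproof a).

Lemma lmul_bound (a : A) : op_bound (lmul a) `|a|.
Proof. by move=> x; exact: cnormM. Qed.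

(** Since [A] may lack a unit, [r - a] only makes sense after passing to left multiplications. *)
Definition apos (a : A) : Prop := exists r, pos_bound (lmul a) r.

Lemma cpos_apos (a : A) : cpos a -> apos a.
Proof.
move=> [b ->].
have [r br] := pos_bound_adjM selfmod_CS (normr_ge0 b) (@lmul_bound b).
exists r; suff -> : lmul (cmul (cstar b) b) = adj (lmul b) * lmul b by [].
by apply: adjointable_eq => x; exact/esym/cmulA.
Qed.

Lemma lmulD (a b : A) : lmul (a + b) = lmul a + lmul b.
Proof. by apply: adjointable_eq => x; exact: cmulDl. Qed.

Lemma aposD (a b : A) : apos a -> apos b -> apos (a + b).
Proof.
move=> [r ar] [s bs]; exists (r + s); rewrite lmulD; exact: pos_boundD.
Qed.

Lemma apos0 : apos 0.
Proof.
exists 0; split=> //.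
  by apply: adjointable_eq => x /=; rewrite cstar0.
move=> x; rewrite mul0r scale0r sub0r aopNE normrN /=.
by rewrite -[0](scale0r 0) cmulZl scale0r normr0.
Qed.

Lemma norm_le_add_apos (a b : A) : apos a -> apos b -> `|a| <= `|a + b|.
Proof.
move=> [r ar] [s bs]; have [->|a0] := eqVneq a 0; first by rewrite normr0.
have ab : op_bound (lmul a + lmul b) `|a + b|.
  by rewrite -lmulD; exact: lmul_bound.
(* Evaluated at [a^*], the operator bound reads [|a|^2 <= |a + b| |a|] by the C*-identity. *)
have := op_bound_add_pos (normr_ge0 _) ar bs ab (cstar a : selfmod).
have na : 0 < `|a| by rewrite normr_gt0.
rewrite -[`|cstar a : selfmod|]/(`|cstar a : A|) cstar_norm => H.
rewrite -(ler_pM2r na) (le_trans _ H)// -expr2 -(cstar_norm a) -cnorm_star.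
by rewrite cstarK.
Qed.

End SelfModule.

(** * Norm comparison through inner products *)

Section Positivity.
Variables (R : realType) (A : cstarAlgType R).
Implicit Types H K : hilbertModType A.

Lemma inner_apos H (x : H) : apos (inner x x).
Proof. exact/cpos_apos/inner_ge0. Qed.


Lemma norm_le_of_inner H K (x : H) (y : K) (a : A) :
  apos a -> inner y y = inner x x + a -> `|x| <= `|y|.
Proof.
move=> a0 e; rewrite -(ler_pXn2r (n := 2)) ?nnegrE// !norm_inner e.
by apply: norm_le_add_apos => //; exact: inner_apos.
Qed.

End Positivity.

(** * Uniqueness of square roots, and density of ranges *)

Section PositiveOperators.
Variables (R : realType) (A : cstarAlgType R).
Implicit Types H K L : hilbertModType A.

Lemma inner_eq0 H (x : H) : inner x x = 0 :> A -> x = 0.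
Proof.
by move=> xx; apply/normr0_eq0/eqP; rewrite -sqrf_eq0 norm_inner xx normr0.
Qed.

Lemma inner_add_eq0 H K (x : H) (y : K) :
  inner x x + inner y y = 0 :> A -> x = 0.
Proof.
move=> xy; apply/normr0_eq0/eqP; rewrite -sqrf_eq0 norm_inner eq_le normr_ge0.
rewrite andbT -(normr0 A) -xy; apply: norm_le_add_apos; exact: inner_apos.
Qed.

Lemma proj_bound H (P : projection H) : op_bound P 1.
Proof.
move=> x; rewrite mul1r.
apply: (norm_le_of_inner (inner_apos (x - P x))).
rewrite -projP projK innerBl !innerBr -[inner (P x) (P x)]projP projK.
by rewrite projP subrr subr0 addrC addrNK.
Qed.

(** [asqrt] chooses some root [S = V^* V], about which no commutation is known; it has to be
    identified with the root [D] of [ex_sqrt]. [S] commutes with [S^2 = T], hence with [D], so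
    [(S - D) (S + D) = 0]. On the range of [N = S - D] the positive forms of [S] and [D] add up to
    zero, so both operators vanish there and [N^2 = 0]. *)
Lemma asqrtP H (T : adjointable H H) r : pos_bound T r ->
  [/\ adj (asqrt T) = asqrt T, asqrt T * asqrt T = T &
      forall Z, GRing.comm Z T -> GRing.comm Z (asqrt T)].
Proof.
move=> Tr; have [D [Dr DD Dc]] := ex_sqrt Tr.
(* A second root exhibits [D] as [W^* W], as [positive_op] demands. *)
have [W [[_ Wa _] WW _]] := ex_sqrt Dr; have [_ Da _] := Dr.
have Dp : positive_op D by exists W; rewrite Wa -WW.
have [/=] := xgetPex (0 : adjointable H H)
  (ex_intro (fun S => positive_op S /\ S \oA S = T) D (conj Dp DD)).
rewrite -/(asqrt T); set S := asqrt T => -[V SV] SS.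
have Sa : adj S = S by rewrite SV adj_comp adjK.
have SD : GRing.comm S D by apply: Dc; rewrite -SS; exact: (commrM (erefl _)).
suff -> : S = D by split.
pose N := S - D; have Na : adj N = N by rewrite adj_sub Sa Da.
have NN0 : N * (S + D) = 0.
  by rewrite mulrBl !mulrDr SD DD [S * S]SS opprD addrA addrK subrr.
have SN0 x : S (N x) = 0 /\ D (N x) = 0.
  have VW : inner (V (N x)) (V (N x)) + inner (W (N x)) (W (N x)) = 0 :> A.
    have -> : inner (V (N x)) (V (N x)) = inner (N x) (S (N x)) :> A.
      by rewrite adjP SV.
    have -> : inner (W (N x)) (W (N x)) = inner (N x) (D (N x)) :> A.
      by rewrite adjP Wa -WW.
    rewrite -innerDr -aopDE adjP Na -[N ((S + D) _)]aopME NN0.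
    exact: inner0r.
  split; first by rewrite SV -[LHS]/(adj V (V (N x))) (inner_add_eq0 VW) aop0.
  by rewrite -WW aopME (inner_add_eq0 (etrans (addrC _ _) VW)) aop0.
apply/eqP; rewrite -subr_eq0 -/N; apply/eqP/adjointable_eq => x.
apply: inner_eq0; rewrite adjP Na.
by have [SN DN] := SN0 x; rewrite {1}/N aopDE aopNE SN DN subrr inner0r.
Qed.

Definition op_dense H K (T : adjointable H K) : Prop :=
  forall (y : K) (e : R[i]), 0 < e -> exists x, `|y - T x| < e.

Lemma op_dense_comp H K L (S : adjointable K L) (T : adjointable H K) :
  op_bound S 1 -> op_dense S -> op_dense T -> op_dense (S \oA T).
Proof.
move=> S1 Sd Td z e e0; have e20 : 0 < e / 2 by rewrite divr_gt0.
have [y zy] := Sd z _ e20; have [x yx] := Td y _ e20.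
exists x; rewrite /= -(subrK (S y) z) -addrA -aopB [e]splitr.
rewrite (le_lt_trans (ler_normD _ _))// ltrD//.
by rewrite (le_lt_trans (S1 _))// mul1r.
Qed.

(* The hypotheses say that [T] and [T^*] are contractions, in factored form. *)
Lemma inner_defect H K L L' (T : adjointable K H) (B : adjointable H L)
    (B' : adjointable K L') (u : K) :
  T \oA adj T + adj B \oA B = aid H -> adj T \oA T + adj B' \oA B' = aid K ->
  let Z := adj B' \oA B' in
  inner u u = inner (Z u) (Z u)
    + (inner (T u) (T u) + inner (B (T u)) (B (T u))) :> A.
Proof.
move=> TB TB' Z.
have uE : u = adj T (T u) + Z u by rewrite -[LHS]/(aid K u) -TB'.
(* As [Z = 1 - T^* T] and [B^* B = 1 - T T^*], both sides are [T u - T T^* T u]. *)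
have TZ : T (Z u) = adj B (B (T u)).
  have h : T u = T (adj T (T u)) + adj B (B (T u)).
    by rewrite -[LHS]/(aid H (T u)) -TB.
  by apply: (addrI (T (adj T (T u)))); rewrite -h -aopD -uE.
have e1 : inner u u = inner (T u) (T u) + inner u (Z u) :> A.
  by rewrite {2}uE innerDr -adjP.
have e2 : inner u (Z u) = inner (B (T u)) (B (T u)) + inner (Z u) (Z u) :> A.
  by rewrite {1}uE innerDl adj_subproof TZ -adjP.
by rewrite e1 e2 addrA addrC.
Qed.

Lemma aposMn (a : A) n : apos a -> apos (a *+ n).
Proof.
move=> a0; elim: n => [|n IH]; first exact: apos0.
by rewrite mulrS; exact: aposD.
Qed.

(** Let [Z = 1 - T^* T]. Since [T u - T Z^n u] lies in the range of [T T^*], it suffices that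
    [T Z^n u] becomes small. Each step from [Z^k u] to [Z^(k+1) u] costs [<u, u>] at least
    [<T Z^k u, T Z^k u>], and these terms decrease, so [n <T Z^n u, T Z^n u> <= <u, u>]. The
    factored defects provide the remainders as explicit inner products. *)
Lemma op_dense_mul_adj H K L L' (T : adjointable K H) (B : adjointable H L)
    (B' : adjointable K L') :
  T \oA adj T + adj B \oA B = aid H -> adj T \oA T + adj B' \oA B' = aid K ->
  op_dense T -> op_dense (T \oA adj T).
Proof.
move=> TB TB' Td; pose Z := adj B' \oA B'; pose X := adj B \oA B.
have ZE u : Z u = u - adj T (T u).
  by apply: (canRL (addrK _)); rewrite addrC -[RHS]/(aid K u) -TB'.
have XE u : X u = u - T (adj T u).
  by apply: (canRL (addrK _)); rewrite addrC -[RHS]/(aid H u) -TB.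
have TZ u : T (Z u) = X (T u) by rewrite ZE XE aopB.
pose w n u := iter n Z u.
have near_range n u : exists x, T u - T (w n u) = T (adj T x).
  elim: n => [|n [x xE]]; first by exists 0; rewrite subrr !aop0.
  exists (x + T (w n u)); rewrite (_ : w n.+1 u = Z (w n u))// ZE aopB opprB.
  rewrite !aopD -xE.
  by rewrite [X in _ + X = _]addrC addrA.
have sum n u : exists2 c : A,
    apos c & inner u u = inner (T (w n u)) (T (w n u)) *+ n + c.
  suff [c c0 cE] : exists2 c : A, apos c & inner u u
      = inner (w n u) (w n u) + (inner (T (w n u)) (T (w n u)) *+ n + c).
    exists (inner (w n u) (w n u) + c); last by rewrite cE addrCA.
    by apply: aposD => //; exact: inner_apos.
  elim: n => [|n [c c0 cE]].
    by exists 0; [exact: apos0|rewrite mulr0n !addr0].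
  set v := w n u in cE; have wS : w n.+1 u = Z v by [].
  have sTB' : adj T \oA adj (adj T) + adj B' \oA B' = aid K by rewrite adjK.
  have sTB : adj (adj T) \oA adj T + adj B \oA B = aid H by rewrite adjK.
  set b := inner (B (T v)) (B (T v)) : A.
  set d := inner (adj T (T v)) (adj T (T v))
    + inner (B' (adj T (T v))) (B' (adj T (T v))) : A.
  have dv : inner v v = inner (Z v) (Z v) + (inner (T v) (T v) + b) :> A.
    exact: inner_defect TB TB'.
  have dTv : inner (T v) (T v) = inner (X (T v)) (X (T v)) + d :> A.
    exact: inner_defect sTB' sTB.
  rewrite wS TZ; exists (b + d *+ n.+1 + c).
    apply: aposD => //; apply: aposD; first exact: inner_apos.
    by apply/aposMn/aposD; exact: inner_apos.
  (* The new copy of [<T v, T v>] joins the [n] old ones; all [n + 1] are then lowered to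
     [<T Z v, T Z v>]. *)
  rewrite cE dv -addrA; congr (_ + _); rewrite addrACA -mulrS dTv mulrnDl -addrA.
  by congr (_ + _); rewrite addrCA addrA.
move=> y e e0; have e20 : 0 < e / 2 by rewrite divr_gt0.
have [u yu] := Td y _ e20.
have [n wn] : exists n, `|T (w n u)| < e / 2.
  apply: contrapT => /forallNP small.
  have : (e / 2) ^+ 2 = 0.
    apply: (@eq0_of_mulrn_le _ _ (`|u| ^+ 2)); first exact: exprn_ge0 (ltW _).
    move=> n; have [c c0 uc] := sum n.+1 u.
    have /negP := small n.+1; rewrite -real_leNgt ?ger0_real ?(ltW e20)// => ew.
    apply: (@le_trans _ _ (`|inner (T (w n.+1 u)) (T (w n.+1 u)) *+ n.+1 : A|)).
      by rewrite normrMn -norm_inner ler_wMn2r// lerXn2r ?nnegrE ?(ltW e20).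
    rewrite norm_inner uc; apply: norm_le_add_apos => //.
    by apply/aposMn/inner_apos.
  by move/eqP; rewrite sqrf_eq0 gt_eqF.
have [x xE] := near_range n u; exists x; rewrite /= -xE opprB addrCA addrC.
rewrite [e]splitr (le_lt_trans (ler_normD _ _))// ltrD//.
Qed.

End PositiveOperators.

(** * Extending an isometric correspondence to a unitary *)

Section Extension.
Variables (R : realType) (A : cstarAlgType R).
Implicit Types H K : hilbertModType A.

Definition dense_range (X : Type) H (f : X -> H) : Prop :=
  forall (h : H) (e : R[i]), 0 < e -> exists x, `|h - f x| < e.

Section IsometricPair.
Variables (X : Type) (H K : hilbertModType A) (f : X -> H) (g : X -> K).
Hypothesis fg : forall x y, inner (f x) (f y) = inner (g x) (g y) :> A.
Hypothesis fd : dense_range f.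

(* The closure of the relation [f x ~ g x]. *)
Definition ext_rel (h : H) (v : K) : Prop := forall n, exists x,
  `|h - f x| *+ n.+1 <= 2 /\ `|v - g x| *+ n.+1 <= 2.

Lemma ext_dist x y : `|f x - f y| = `|g x - g y|.
Proof.
apply/eqP; rewrite -(eqrXn2 (n := 2))//; apply/eqP.
by rewrite !norm_inner !innerBl !innerBr !fg.
Qed.

(** If [f x_n] tends to [h], then [g x_n] is Cauchy since [f] and [g] have the same distances. The 2
    in [ext_rel] is the sum of the two errors [1 / (n + 1)] in that estimate. *)
Lemma ext_rel_ex h : exists v, ext_rel h v.
Proof.
have /choice[u uP] n : exists x, `|h - f x| *+ n.+1 <= 1.
  have n0 : (0 : R[i]) < n.+1%:R by rewrite ltr0n.
  have [x hx] : exists x, `|h - f x| < n.+1%:R^-1 by apply: fd; rewrite invr_gt0.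
  by exists x; rewrite -mulr_natr -ler_pdivlMr// mul1r ltW.
have uu n m : (n <= m)%N -> `|g (u m) - g (u n)| *+ n.+1 <= 2.
  move=> nm; rewrite -ext_dist -(subrK h (f (u m))) -addrA.
  rewrite (le_trans (ler_wMn2r _ (ler_normD _ _)))// mulrnDl.
  rewrite -[2]/(1 + 1) lerD// distrC (le_trans _ (uP m))//.
  by rewrite ler_wpMn2l.
have [v vP] := cvg_rate uu.
exists v => n; exists (u n); split => //.
by rewrite (le_trans (uP n))// ler1n.
Qed.

(** From this one identity come adjointness, unitarity and the values of the extension. *)
Lemma ext_rel_inner h h' v v' :
  ext_rel h v -> ext_rel h' v' -> inner h h' = inner v v' :> A.
Proof.
pose c (L : hilbertModType A) (a b : L) := 4 * (2 * `|b|) + 4 * ((`|a| + 2) * 2).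
have close (L : hilbertModType A) n (a a' b b' : L) :
    `|a - b| *+ n.+1 <= 2 -> `|a' - b'| *+ n.+1 <= 2 ->
    `|inner a a' - inner b b' : A| *+ n.+1 <= c L a a'.
  move=> ab ab'.
  have -> : inner a a' - inner b b' = inner (a - b) a' + inner b (a' - b') :> A.
    by rewrite innerBl innerBr addrA addrNK.
  rewrite (le_trans (ler_wMn2r _ (ler_normD _ _)))// mulrnDl lerD//.
    exact: inner_rate_l.
  rewrite (le_trans (inner_rate_r _ ab'))// ler_wpM2l// ler_wpM2r//.
  rewrite -[b](subKr a) (le_trans (ler_normB _ _))// lerD2l (le_trans _ ab)//.
  by rewrite mulrS lerDl mulrn_wge0.
move=> hv hv'; apply: (@eq_of_rate R A _ _ (c H h h') (c K v v')) => n.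
have [[x [hx vx]] [y [hy vy]]] := (hv n, hv' n).
by exists (inner (f x) (f y)); [exact: close|rewrite fg; exact: close].
Qed.

Lemma ext_rel_fg x : ext_rel (f x) (g x).
Proof. by move=> n; exists x; rewrite !subrr !normr0 mul0rn. Qed.

End IsometricPair.

Lemma ext_rel_sym (X : Type) H K (f : X -> H) (g : X -> K) h v :
  ext_rel f g h v -> ext_rel g f v h.
Proof. by move=> hv n; have [x [hx vx]] := hv n; exists x. Qed.

(** Equal Gram kernels suffice, with no linearity of [f] or [g]: the extension [W] of [g x |-> f x]
    is an adjoint of [V], and linearity follows from adjointability. *)
Lemma ex_unitary (X : Type) H K (f : X -> H) (g : X -> K) :
  (forall x y, inner (f x) (f y) = inner (g x) (g y) :> A) ->
  dense_range f -> dense_range g ->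
  exists V : adjointable H K, unitary_op V /\ forall x, V (f x) = g x.
Proof.
move=> fg fd gd.
have gf x y : inner (g x) (g y) = inner (f x) (f y) :> A by [].
have /choice[V VP] := ext_rel_ex fg fd.
have /choice[W WP] := ext_rel_ex gf gd.
have WP' v : ext_rel f g (W v) v by exact/ext_rel_sym.
have VW x y : inner (V x) y = inner x (W y) :> A.
  exact/esym/(ext_rel_inner fg).
exists (Adjointable VW); split; first split.
- apply: adjointable_eq => x; apply: inner_inj => y /=.
  by rewrite -VW; exact/esym/(ext_rel_inner fg).
- apply: adjointable_eq => x; apply: inner_inj => y /=.
  rewrite -[LHS]inner_star VW inner_star; exact: (ext_rel_inner fg).
move=> x; apply: inner_inj => y /=.
rewrite -[LHS]inner_star VW inner_star.
by apply: (ext_rel_inner fg) => //; exact: ext_rel_fg.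
Qed.

End Extension.

(** * Cancellation along dense ranges *)

Section DenseOperators.
Variables (R : realType) (A : cstarAlgType R).
Implicit Types H K L : hilbertModType A.

Lemma op_dense_eq0 H K (T : adjointable H K) x :
  op_dense T -> (forall y, inner x (T y) = 0 :> A) -> x = 0.
Proof.
move=> Td xT; apply: inner_eq0; apply/normr0_eq0.
apply: (@eq0_of_mulrn_le _ _ (4 * (`|x| * 1))) => // n.
have n0 : (0 : R[i]) < n.+1%:R by rewrite ltr0n.
have [y xy] : exists y, `|x - T y| < n.+1%:R^-1 by apply: Td; rewrite invr_gt0.
rewrite -[inner x x]subr0 -(xT y) -innerBr inner_rate_r//.
by rewrite -mulr_natr -ler_pdivlMr// mul1r ltW.
Qed.

Lemma op_dense_inj H K L (T : adjointable H K) (S S' : adjointable K L) :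
  op_dense T -> S \oA T = S' \oA T -> S = S'.
Proof.
move=> Td ST; apply: adjointable_eq => y; apply: inner_inj => z.
apply/eqP; rewrite -subr_eq0 -innerBr -[S y - S' y]/((S - S') y).
rewrite -[S - S']adjK -adjP.
suff -> : adj (S - S') z = 0 by rewrite inner0l.
apply: (op_dense_eq0 Td) => x; rewrite adjP adjK.
by rewrite aopDE aopNE -[S (T x)]/((S \oA T) x) ST subrr inner0r.
Qed.

Lemma op_dense_selfadj_inj H (T : adjointable H H) :
  adj T = T -> op_dense T -> injective T.
Proof.
move=> Ta Td x y xy; apply/eqP; rewrite -subr_eq0; apply/eqP.
apply: (op_dense_eq0 Td) => z.
by rewrite -{1}Ta -adjP aopB xy subrr inner0l.
Qed.

End DenseOperators.

(** * Compressions of projections *)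

Section Corners.
Variables (R : realType) (A : cstarAlgType R) (H : hilbertModType A).
Implicit Types E F G P Q : projection H.

Lemma val_corner E T F (x : rng F) : val (corner E T F x) = E (T (val x)).
Proof. by rewrite cornerE /= rngP. Qed.

Lemma adj_corner E T F : adj (corner E T F) = corner F (adj T) E.
Proof. exact: adjointable_eq. Qed.

Lemma corner_bound E (T : adjointable H H) F :
  op_bound T 1 -> op_bound (corner E T F) 1.
Proof.
move=> T1 x; rewrite -[`|x|]/(`|val x|) -[leLHS]/(`|val (corner E T F x)|).
rewrite val_corner (le_trans (proj_bound _ _))// mul1r; exact: T1.
Qed.

Lemma corner_projC E G :
  corner E (projC G) E = aid (rng E) - corner E G E.
Proof.
apply: adjointable_eq => x; apply: val_inj.
rewrite val_corner -[RHS]/(val x - val (corner E G E x)) val_corner.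
by rewrite -[projC G (val x)]/(val x - G (val x)) aopB rngP.
Qed.

(** For [T = E G] from [R(G)] to [R(E)], the defect [1 - T T^* = E (1 - G) E] factors through
    [R(1 - G)], as [op_dense_mul_adj] demands; exchanging [E] and [G] handles [T^*]. *)
Lemma corner_defect E G :
  corner E (aid H) G \oA adj (corner E (aid H) G) +
  adj (corner (projC G) (aid H) E) \oA corner (projC G) (aid H) E = aid (rng E).
Proof.
apply: adjointable_eq => x; apply: val_inj.
rewrite !adj_corner.
rewrite -[LHS]/(val (corner E (aid H) G (corner G (adj (aid H)) E x)) +
  val (corner E (adj (aid H)) (projC G) (corner (projC G) (aid H) E x))).
rewrite !val_corner -aopD -[RHS]rngP; congr (E _).
by rewrite -[LHS]/(G (val x) + (val x - G (val x))) addrC addrNK.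
Qed.

Lemma op_dense_corner E G :
  op_dense (corner E (aid H) G) -> op_dense (corner E G E).
Proof.
move=> d; have h := corner_defect G E.
have h' : adj (corner E (aid H) G) \oA corner E (aid H) G +
    adj (corner (projC E) (aid H) G) \oA corner (projC E) (aid H) G = aid (rng G).
  by rewrite -[RHS]h !adj_corner (adj_one H).
have := op_dense_mul_adj (corner_defect E G) h' d.
suff -> : corner E (aid H) G \oA adj (corner E (aid H) G) = corner E G E by [].
rewrite adj_corner; apply: adjointable_eq => x; apply: val_inj.
by rewrite /= rngP !projK.
Qed.

(** [E] kills the complement [ker G1 /\ ker G2] of the closure, so [R(E)] lies in the closure
    itself. Applying [E] to an approximation [G1 w + G2 w] then leaves [E G2 w]. *)
Lemma op_dense_complemented E G1 G2 :
  complemented (closure (op_range (proj_op G1 + proj_op G2))) ->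
  (forall x, E (G1 x) = 0) -> (forall z, G1 z = 0 -> G2 z = 0 -> E z = 0) ->
  op_dense (corner E G2 E).
Proof.
move=> Mc EG1 EG2; apply: op_dense_corner => y e e0.
have [m [z [Mm Nz yE]]] := Mc (val y).
have z0 : z = 0.
  apply: inner_eq0; have : inner z m = 0 :> A by apply: Nz.
  have [] : (kernel G1 `&` kernel G2)%classic z by rewrite -perp_closure_range.
  move=> /= z1 z2; have : inner z (val y) = 0 :> A.
    by rewrite -rngP -projP EG2// inner0l.
  by rewrite yE innerDr => + zm; rewrite zm add0r.
have [_ [[w _ <-]]] := Mm _ (nbhsx_ballx m _ e0).
rewrite -ball_normE /= => mw; exists (to_rng G2 w).
rewrite -[`|_|]/(`|val y - val (corner E (aid H) G2 (to_rng G2 w))|) val_corner.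
have -> : val y - E (aid H (val (to_rng G2 w))) = E (m - (G1 w + G2 w)).
  by rewrite aopB aopD EG1 add0r -{1}[m]addr0 -z0 -yE rngP.
by rewrite (le_lt_trans (proj_bound _ _))// mul1r.
Qed.

End Corners.

(** * The six pieces of a harmonious pair *)

Section Pieces.
Variables (R : realType) (A : cstarAlgType R) (H : hilbertModType A).
Variables (P Q : projection H) (PQ : harmonious P Q).

Lemma range_sub_fix (E F : projection H) :
  range E `<=` range F -> (forall x, F (E x) = E x) /\ (forall x, E (F x) = E x).
Proof.
move=> EF; split=> x; first by apply/range_projP/EF; exists x.
by rewrite -[LHS]/((E \oA F) x) proj_leC.
Qed.

Lemma range_sub_kernel (E F : projection H) :
  range E `<=` kernel F -> (forall x, F (E x) = 0) /\ (forall x, E (F x) = 0).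
Proof.
move=> EF; split=> x; first by apply: EF; exists x.
apply: inner_inj => y; rewrite inner0r -!projP; rewrite (_ : F (E y) = 0) ?inner0l//.
by apply: EF; exists y.
Qed.

Let p1 := P1 PQ. Let p2 := P2 PQ. Let p3 := P3 PQ. Let p4 := P4 PQ.
Let p5 := P5 PQ. Let p6 := P6 PQ.

Lemma p1P : (forall x, P (p1 x) = p1 x) /\ (forall x, p1 (P x) = p1 x).
Proof. by apply: range_sub_fix; rewrite range_P1 => x []. Qed.
Lemma p1Q : (forall x, Q (p1 x) = p1 x) /\ (forall x, p1 (Q x) = p1 x).
Proof. by apply: range_sub_fix; rewrite range_P1 => x []. Qed.
Lemma p2P : (forall x, P (p2 x) = p2 x) /\ (forall x, p2 (P x) = p2 x).
Proof. by apply: range_sub_fix; rewrite range_P2 => x []. Qed.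
Lemma p2Q : (forall x, Q (p2 x) = 0) /\ (forall x, p2 (Q x) = 0).
Proof. by apply: range_sub_kernel; rewrite range_P2 => x []. Qed.
Lemma p3P : (forall x, P (p3 x) = 0) /\ (forall x, p3 (P x) = 0).
Proof. by apply: range_sub_kernel; rewrite range_P3 => x []. Qed.
Lemma p3Q : (forall x, Q (p3 x) = p3 x) /\ (forall x, p3 (Q x) = p3 x).
Proof. by apply: range_sub_fix; rewrite range_P3 => x []. Qed.
Lemma p4P : (forall x, P (p4 x) = 0) /\ (forall x, p4 (P x) = 0).
Proof. by apply: range_sub_kernel; rewrite range_P4 => x []. Qed.
Lemma p4Q : (forall x, Q (p4 x) = 0) /\ (forall x, p4 (Q x) = 0).
Proof. by apply: range_sub_kernel; rewrite range_P4 => x []. Qed.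

Lemma p5x x : p5 x = P x - p1 x - p2 x. Proof. by []. Qed.
Lemma p6x x : p6 x = x - P x - p3 x - p4 x. Proof. by []. Qed.

Lemma pieces_sum x : p1 x + p2 x + p3 x + p4 x + p5 x + p6 x = x.
Proof.
rewrite p5x p6x.
have -> : x - P x - p3 x - p4 x = x - P x - (p3 x + p4 x) by rewrite opprD addrA.
have -> : P x - p1 x - p2 x = P x - (p1 x + p2 x) by rewrite opprD addrA.
rewrite -[p1 x + p2 x + _ + _]addrA [p1 x + p2 x + (p3 x + _)]addrC.
by rewrite [X in X + _]addrACA subrr addr0 [LHS]addrC addrA !addrNK.
Qed.

Lemma piece1_0 : (forall x, p1 (p5 x) = 0) /\ (forall x, p1 (p6 x) = 0).
Proof.
have [[_ pP] [_ pQ]] := (p1P, p1Q).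
have p12 x : p1 (p2 x) = 0 by rewrite -pQ p2Q.1 aop0.
have p13 x : p1 (p3 x) = 0 by rewrite -pP p3P.1 aop0.
have p14 x : p1 (p4 x) = 0 by rewrite -pP p4P.1 aop0.
split=> x; rewrite ?p5x ?p6x !aopB ?p12 ?p13 ?p14 pP ?projK
  ?subrr ?subr0 ?subrr//.
Qed.

Lemma piece3_0 : (forall x, p3 (p5 x) = 0) /\ (forall x, p3 (p6 x) = 0).
Proof.
have [[_ pP] [_ pQ]] := (p3P, p3Q).
have p31 x : p3 (p1 x) = 0 by rewrite -p1P.1 pP.
have p32 x : p3 (p2 x) = 0 by rewrite -p2P.1 pP.
have p34 x : p3 (p4 x) = 0 by rewrite -pQ p4Q.1 aop0.
split=> x; rewrite ?p5x ?p6x !aopB ?p31 ?p32 ?p34 pP ?projK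
  ?subr0 ?subrr ?subr0//.
Qed.

(** [p1 Q = p1] and [p3 Q = p3] vanish on [H5] and [H6], while [p2 Q = p4 Q = 0]; so [Q x] has
    components in [H5] and [H6] only. *)
Lemma Q_block_idem x : p5 x = x \/ p6 x = x ->
  Q (p5 (Q x)) + Q (p6 (Q x)) = Q x.
Proof.
have sum y : p1 y = 0 -> p2 (Q y) = 0 -> p3 y = 0 -> p5 (Q y) + p6 (Q y) = Q y.
  move=> y1 y2 y3; rewrite -[RHS]pieces_sum p1Q.2 p3Q.2 p4Q.2 y1 y2 y3.
  by rewrite !add0r.
move=> x56; rewrite -aopD sum ?projK ?p2Q.2//.
  by case: x56 => <-; [exact: piece1_0.1|exact: piece1_0.2].
by case: x56 => <-; [exact: piece3_0.1|exact: piece3_0.2].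
Qed.

Lemma corner_block_idem (E F : projection H) : E = p5 \/ E = p6 ->
  corner F Q p5 \oA corner p5 Q E + corner F Q p6 \oA corner p6 Q E
  = corner F Q E.
Proof.
move=> E56; apply: adjointable_eq => x; apply: val_inj.
rewrite -[LHS]/(val (corner F Q p5 (corner p5 Q E x)) +
  val (corner F Q p6 (corner p6 Q E x))) !val_corner -aopD Q_block_idem//.
by move: (val x) (rngP x) => v; case: E56 => ->; [left|right].
Qed.

(** Prepares [op_dense_complemented] with [G1 = 1 - P]: the common kernels with [Q] and [1 - Q] are
    [H2] and [H1], both removed from [P] in [p5]. *)
Lemma p5_annihil : [/\ forall x, p5 (projC P x) = 0,
  (forall z, projC P z = 0 -> Q z = 0 -> p5 z = 0) &
  (forall z, projC P z = 0 -> projC Q z = 0 -> p5 z = 0)].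
Proof.
have fixP z : projC P z = 0 -> P z = z by move/eqP; rewrite subr_eq0 => /eqP.
have fixQ z : projC Q z = 0 -> Q z = z by move/eqP; rewrite subr_eq0 => /eqP.
split=> [x|z /fixP Pz Qz|z /fixP Pz /fixQ Qz].
- rewrite -[projC P x]/(x - P x) p5x !aopB projK p1P.2 p2P.2.
  by rewrite !subrr.
- have zr : p2 z = z.
    by apply/range_projP; rewrite range_P2; split=> //; exact/range_projP.
  by rewrite p5x Pz zr -[p1 z]p1Q.2 Qz aop0 subr0 subrr.
- have zr : p1 z = z.
    by apply/range_projP; rewrite range_P1; split; exact/range_projP.
  by rewrite p5x Pz zr -Qz p2Q.2 Qz subrr subr0.
Qed.

Lemma p6_annihil : [/\ forall x, p6 (P x) = 0,
  (forall z, P z = 0 -> Q z = 0 -> p6 z = 0) &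
  (forall z, P z = 0 -> projC Q z = 0 -> p6 z = 0)].
Proof.
have fixQ z : projC Q z = 0 -> Q z = z by move/eqP; rewrite subr_eq0 => /eqP.
split=> [x|z Pz Qz|z Pz /fixQ Qz].
- by rewrite p6x projK p3P.2 p4P.2 subrr !subr0.
- have zr : p4 z = z by apply/range_projP; rewrite range_P4.
  by rewrite p6x Pz zr -[p3 z]p3Q.2 Qz aop0 !subr0 subrr.
- have zr : p3 z = z.
    by apply/range_projP; rewrite range_P3; split=> //; exact/range_projP.
  by rewrite p6x Pz zr -{3}Qz p4Q.2 !subr0 subrr.
Qed.

(** Each of the four complementation conditions of harmony is spent on exactly one of the four
    densities. *)
Lemma op_dense_pieces : [/\ op_dense (corner p5 Q p5),
  op_dense (corner p5 (projC Q) p5), op_dense (corner p6 Q p6) &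
  op_dense (corner p6 (projC Q) p6)].
Proof.
have [c1 c2 c3 c4] := PQ.
have [a5 k5 k5'] := p5_annihil; have [a6 k6 k6'] := p6_annihil.
split.
- exact: (op_dense_complemented (G1 := projC P) (G2 := Q) c3).
- exact: (op_dense_complemented (G1 := projC P) (G2 := projC Q) c4).
- exact: (op_dense_complemented (G1 := P) (G2 := Q) c1).
- exact: (op_dense_complemented (G1 := P) (G2 := projC Q) c2).
Qed.

End Pieces.

Theorem theorem4p6 (R : realType) (A : cstarAlgType R) (H : hilbertModType A)
    (P Q : projection H) (PQ : harmonious P Q) :
  let H5 : hilbertModType A := rng (P5 PQ) in
  let H6 : hilbertModType A := rng (P6 PQ) in
  let T : adjointable (H5 * H6)%type (H5 * H6)%type :=
    block_op (corner (P5 PQ) Q (P5 PQ)) (corner (P5 PQ) Q (P6 PQ))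
             (adj (corner (P5 PQ) Q (P6 PQ))) (corner (P6 PQ) Q (P6 PQ)) in
  let Q0 : adjointable H5 H5 := corner (P5 PQ) Q (P5 PQ) in
  let Q1 : adjointable H5 H5 := aid H5 - Q0 in
  [/\ positive_op Q0, injective Q0 & contractive_op Q0] /\
  [/\ positive_op Q1, injective Q1 & contractive_op Q1] /\
  exists U0 : adjointable H6 H5,
    unitary_op U0 /\
    T = block_op Q0 (asqrt Q0 \oA asqrt Q1 \oA U0)
                 (adj U0 \oA asqrt Q0 \oA asqrt Q1) (adj U0 \oA Q1 \oA U0).
Proof.
move=> H5 H6 T Q0 Q1.
have Q1E : Q1 = corner (P5 PQ) (projC Q) (P5 PQ) by rewrite corner_projC.
pose S : adjointable H6 H5 := corner (P5 PQ) Q (P6 PQ).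
pose Q6 : adjointable H6 H6 := corner (P6 PQ) Q (P6 PQ).
have [Q0d Q1d Q6d Q6d'] := op_dense_pieces PQ.
rewrite -Q1E -/Q0 corner_projC -/Q6 in Q0d Q1d Q6d Q6d'.
have Q0a : adj Q0 = Q0 by rewrite adj_corner proj_adj.
have Q1a : adj Q1 = Q1 by rewrite Q1E adj_corner proj_adj.
have Q0b : op_bound Q0 1 by exact/corner_bound/proj_bound.
have Q1b : op_bound Q1 1 by rewrite Q1E; exact/corner_bound/proj_bound.
have Q6b : op_bound Q6 1 by exact/corner_bound/proj_bound.
(* With radius 1, positivity of either of [Q0] and [Q1] is contractivity of the other. *)
have Q0p : pos_bound Q0 1 by split=> //; rewrite scale1r.
have Q1p : pos_bound Q1 1.
  by split=> //; rewrite scale1r opprB addrC addrNK.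
have [s0a s0s s0c] := asqrtP Q0p; have [s1a s1s s1c] := asqrtP Q1p.
set s0 := asqrt Q0 in s0a s0s s0c *; set s1 := asqrt Q1 in s1a s1s s1c *.
have s0Q0 : GRing.comm s0 Q0 by rewrite -s0s; exact: commrM.
have s0Q1 : GRing.comm s0 Q1 by apply: commrB => //; exact: commr1.
have Q1Q0 : GRing.comm Q1 Q0 by apply/esym/commrB => //; exact: commr1.
have s0s1 : GRing.comm s0 s1 by exact: s1c.
pose G : adjointable H5 H5 := s0 * s1.
have Ga : adj G = G by exact: adj_comm.
have GG : G * G = Q0 * Q1.
  by rewrite -s0s -s1s /G -!mulrA; congr (_ * _); rewrite !mulrA -s0s1.
have adjSE : adj S = corner (P6 PQ) Q (P5 PQ) by rewrite adj_corner proj_adj.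
have idem5 F := corner_block_idem (PQ := PQ) F (or_introl erefl).
have idem6 F := corner_block_idem (PQ := PQ) F (or_intror erefl).
have SS : S \oA adj S = Q0 * Q1.
  rewrite adjSE mulrBr [Q0 * aid H5]mulr1 -{1}[Q0]idem5.
  by rewrite addrAC subrr add0r.
have SS' : adj S \oA S = Q6 \oA (aid H6 - Q6).
  rewrite adjSE -[RHS]/(Q6 * (1 - Q6)) mulrBr mulr1 -{1}[Q6]idem6.
  by rewrite addrK.
have SQ : Q6 \oA adj S = adj S \oA Q1.
  rewrite adjSE; set S' := corner _ _ _; apply: adjointable_eq => x.
  transitivity (S' x - S' (Q0 x)); last by rewrite -aopB.
  have {1}<- : (S' \oA Q0 + Q6 \oA S') x = S' x by rewrite idem5.
  by rewrite aopDE addrAC subrr add0r.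
(* The range of [G] contains that of [G^2 = Q0 Q1], a product of contractions with dense ranges. *)
have Gd : op_dense G.
  move=> y e e0; have [x yx] := op_dense_comp Q0b Q0d Q1d y e0.
  by exists (G x); rewrite -[G (G x)]aopME GG.
have Sd : op_dense (adj S).
  move=> y e e0; have [x yx] := op_dense_comp Q6b Q6d Q6d' y e0.
  by exists (S x); rewrite -[adj S (S x)]/((adj S \oA S) x) SS'.
have GS x y : inner (G x) (G y) = inner (adj S x) (adj S y) :> A.
  rewrite !adjP Ga adjK -[G (G y)]aopME GG -SS.
  by [].
have [V [[VV VV'] VG]] := ex_unitary GS Gd Sd.
have VGS : V \oA G = adj S by exact: adjointable_eq.
split; first split.
- by exists s0; rewrite s0a.
- exact: op_dense_selfadj_inj.
- by move=> x; rewrite -[leRHS]mul1r; exact: Q0b.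
split; first split.
- by exists s1; rewrite s1a.
- exact: op_dense_selfadj_inj.
- by move=> x; rewrite -[leRHS]mul1r; exact: Q1b.
exists (adj V); split; first by rewrite /unitary_op adjK.
have SE : S = G \oA adj V.
  by rewrite -[LHS]adjK -VGS adj_comp Ga.
have Q6V : Q6 \oA V = V \oA Q1.
  have Q1G : GRing.comm Q1 G.
    by apply: commrM; [exact/esym|rewrite -s1s; apply/esym/commrM].
  (* Composed with [G], both sides agree: [Q6 V G = Q6 S^* = S^* Q1 = V G Q1 = V Q1 G]. *)
  apply: (op_dense_inj Gd).
  by rewrite -acomp_assoc VGS SQ -VGS -acomp_assoc -[G \oA Q1]Q1G acomp_assoc.
have Q6E : Q6 = V \oA Q1 \oA adj V.
  by rewrite -Q6V -acomp_assoc VV'; exact: adjointable_eq.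
by rewrite /T -/Q0 -/S -/Q6 adjK {1}Q6E -VGS {1}SE acomp_assoc.
Qed.
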